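(* Let $k$ be a field, $n\ge1$ an integer, $q=(q_{ij})$ a multiplicatively antisymmetric $n\times n$ matrix over $k^\times$, and $R=k_q[[x_1,\ldots,x_n]]$ the $q$-commutative power series ring. Let $W$ be the set of subsets of $\{1,\ldots,n\}$, and for $w\in W$ let $$\operatorname{Spec}_wR=\{P\in\operatorname{Spec}R \mid x_i\in P\Leftrightarrow i\in w\},$$ with the subspace topology from $\operatorname{Spec}R$. Then: (a) $\operatorname{Spec}R=\bigsqcup_{w\in W}\operatorname{Spec}_wR$, each $\operatorname{Spec}_wR$ is locally closed in $\operatorname{Spec}R$, and the closure in $\operatorname{Spec} R$ of each $\operatorname{Spec}_wR$ is a union of subsets $\operatorname{Spec}_{w'}R$ for suitable $w'\in W$. (b) For each $w\in W$, the assignment $P\mapsto (P/J_w)L_w$ is a homeomorphism $\Theta_w\colon\operatorname{Spec}_wR\to\operatorname{Spec}L_w$, with $\Theta_w(J_w)=0$. (c) For each $w\in W$, the center $Z_w$ of $L_w$ is a commutative noetherian domain, and $\operatorname{Spec}_wR$ is homeomorphic to $\operatorname{Spec}Z_w$.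
   Context: Multiplicatively antisymmetric means $q_{ii}=1$ and $q_{ij}=q_{ji}^{-1}\in k^\times$ for all $i,j$. The ring $R=k_q[[x_1,\ldots,x_n]]$ is the associative unital $k$-algebra of formal skew power series $\sum_{s\in\mathbb{N}^n} c_s x^s$ ($c_s\in k$, $x^s=x_1^{s_1}\cdots x_n^{s_n}$, $\mathbb{N}$ the non-negative integers), with multiplication determined by $x_ix_j=q_{ij}x_jx_i$. It is a noetherian domain and each $x_i$ is normal. $\operatorname{Spec}$ denotes the set of prime ideals of a ring with the Zariski topology. For $w\in W$: $J_w=\langle x_i\mid i\in w\rangle$ is the ideal of $R$ generated by the $x_i$ with $i\in w$; $R_w=R/J_w$ (isomorphic to a $q$-commutative power series ring in the $n-|w|$ variables $x_i$, $i\notin w$, for the corresponding submatrix of $q$; in particular $J_w$ is completely prime); $X_w$ is the multiplicatively closed subset of $R_w$ generated by $1$ and the images of the $x_i$, $i\notin w$ (consisting of normal regular elements of $R_w$); and $L_w=R_wX_w^{-1}$ is the Ore localization. *)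

(* Defs.v *)
From HB Require Import structures.
From mathcomp Require Import all_boot all_order all_algebra.
From mathcomp Require Import all_classical topology.
From mathcomp Require Import ring.

Set Implicit Arguments.
Unset Strict Implicit.
Unset Printing Implicit Defensive.

Import GRing.Theory.

Local Open Scope classical_set_scope.
Local Open Scope ring_scope.

Section Ideals.
Variable R : pzRingType.
Implicit Types (I J P S : set R).

(* Two-sided ideals; closure under opposite follows from a * x with a = -1. *)
Definition is_ideal I :=
  [/\ I 0, forall x y, I x -> I y -> I (x + y),
      forall a x, I x -> I (a * x) & forall a x, I x -> I (x * a)].

Definition ideal_gen S : set R :=
  [set x | forall I, is_ideal I -> S `<=` I -> I x].

(* Primes of a possibly noncommutative ring: the condition is on products of
   ideals, not of elements. *)
Definition prime_ideal P :=
  [/\ is_ideal P, P <> setT &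
      forall I J, is_ideal I -> is_ideal J ->
        (forall a b, I a -> J b -> P (a * b)) -> I `<=` P \/ J `<=` P].

Lemma ideal_gen_ideal S : is_ideal (ideal_gen S).
Proof.
split=> [I [] //|x y hx hy I hI SI|a x hx I hI SI|a x hx I hI SI];
  case: (hI) => I0 ID IM IMr.
- by apply: ID; [apply: hx|apply: hy].
- by apply: IM; apply: hx.
- by apply: IMr; apply: hx.
Qed.

Lemma sub_ideal_gen S : S `<=` ideal_gen S.
Proof. by move=> x Sx I _; apply. Qed.

Lemma ideal_gen_sub S I : is_ideal I -> S `<=` I -> ideal_gen S `<=` I.
Proof. by move=> hI SI x; apply. Qed.

Lemma is_idealT : is_ideal setT. Proof. by split. Qed.

Lemma is_idealI I J : is_ideal I -> is_ideal J -> is_ideal (I `&` J).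
Proof.
move=> [I0 ID IM IMr] [J0 JD JM JMr]; split=> //.
- by move=> x y [Ix Jx] [Iy Jy]; split; [apply: ID|apply: JD].
- by move=> a x [Ix Jx]; split; [apply: IM|apply: JM].
- by move=> a x [Ix Jx]; split; [apply: IMr|apply: JMr].
Qed.

End Ideals.

Record spec (R : pzRingType) := Spec {
  prime_of :> set R;
  prime_ofP : prime_ideal prime_of }.

Section Zariski.
Variable R : pzRingType.

HB.instance Definition _ := gen_eqMixin (spec R).
HB.instance Definition _ := gen_choiceMixin (spec R).

Definition Vset (I : set R) : set (spec R) := [set P | I `<=` P].

Definition zariski_open : set_system (spec R) :=
  [set U | exists2 I, is_ideal I & U = ~` Vset I].

Lemma zariski_openT : zariski_open setT.
Proof.
exists setT; first exact: is_idealT.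
apply/seteqP; split=> // P _ /= TP; case: (prime_ofP P) => _ + _; apply.
by apply/seteqP; split.
Qed.

Lemma zariski_openI : setI_closed zariski_open.
Proof.
move=> _ _ [I hI ->] [J hJ ->]; exists (I `&` J); first exact: is_idealI.
apply/seteqP; split=> P /=.
- move=> [nI nJ] IJP; case: (prime_ofP P) => _ _ /(_ _ _ hI hJ) [|//|//].
  move=> a b Ia Jb; apply: IJP; split; first by case: hI => _ _ _; apply.
  by case: hJ => _ _ + _; apply.
- by move=> nIJ; split=> h; apply: nIJ => x [Ix Jx]; apply: h.
Qed.

Lemma zariski_open_bigU (T : Type) (f : T -> set (spec R)) :
  (forall i, zariski_open (f i)) -> zariski_open (\bigcup_i f i).
Proof.
move=> hf.
pose S := [set x | exists i I, [/\ is_ideal I, f i = ~` Vset I & I x]].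
exists (ideal_gen S); first exact: ideal_gen_ideal.
apply/seteqP; split=> P /=.
- move=> [i _ fP] SP; have [I hI eI] := hf i.
  move: fP; rewrite eI; apply=> x Ix; apply: SP; apply: sub_ideal_gen.
  by exists i, I.
- move=> nP; apply: contrapT => nU; apply: nP; apply: ideal_gen_sub.
    by case: (prime_ofP P).
  move=> x [i [I [hI eI Ix]]]; have : ~ f i P by move=> fP; apply: nU; exists i.
  by rewrite eI => /contrapT; apply.
Qed.

HB.instance Definition _ := isOpenTopological.Build (spec R)
  zariski_openT zariski_openI zariski_open_bigU.

End Zariski.

Section TopologicalNotions.
Variables X Y : topologicalType.

Definition locally_closed (A : set X) :=
  exists U F : set X, [/\ open U, closed F & A = U `&` F].

Definition is_homeomorphism (f : X -> Y) :=
  exists g : Y -> X, [/\ cancel f g, cancel g f, continuous f & continuous g].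

Definition homeomorphic := exists f : X -> Y, is_homeomorphism f.

End TopologicalNotions.

Record tsideal (R : pzRingType) := TSIdeal {
  tsideal_set :> set R;
  tsidealP : is_ideal tsideal_set }.

Section QuotientRing.
Variables (R : pzRingType) (J : tsideal R).

Definition tsideal_pred : R -> bool := fun x => `[< tsideal_set J x >].

Lemma tsideal_zmod_closed : zmod_closed tsideal_pred.
Proof.
have [J0 JD JM _] := tsidealP J.
split=> [|x y /asboolP Jx /asboolP Jy]; apply/asboolP => //.
by apply: JD => //; rewrite -mulN1r; apply: JM.
Qed.

HB.instance Definition _ := GRing.isZmodClosed.Build R tsideal_pred
  tsideal_zmod_closed.

Definition ring_quot := Quotient.quot (GRing.ZmodClosed.clone R tsideal_pred _).

HB.instance Definition _ := GRing.Zmodule.on ring_quot.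

Definition to_quot (x : R) : ring_quot :=
  (\pi_(Quotient.quot (GRing.ZmodClosed.clone R tsideal_pred _)) x)%qT.

Lemma to_quot_surj (y : ring_quot) : exists x, to_quot x = y.
Proof. by exists (repr y); rewrite /to_quot reprK. Qed.

Lemma to_quot_eq x y : to_quot x = to_quot y <-> tsideal_set J (x - y).
Proof.
rewrite /to_quot; split=> [/eqP|Jxy].
  by rewrite -Quotient.idealrBE => /asboolP.
by apply/eqP; rewrite -Quotient.idealrBE; apply/asboolP.
Qed.

Lemma to_quotB : {morph to_quot : x y / x - y}.
Proof. by move=> x y; rewrite /to_quot raddfB. Qed.

Definition quot_one : ring_quot := to_quot 1.
Definition quot_mul (x y : ring_quot) : ring_quot := to_quot (repr x * repr y).

Lemma repr_to_quot x : tsideal_set J (repr (to_quot x) - x).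
Proof. by apply/to_quot_eq; rewrite {1}/to_quot reprK. Qed.

Lemma quot_mulE x y : quot_mul (to_quot x) (to_quot y) = to_quot (x * y).
Proof.
have [J0 JD JM JMr] := tsidealP J.
apply/to_quot_eq; set a := repr _; set b := repr _.
have -> : a * b - x * y = (a - x) * b + x * (b - y).
  by rewrite mulrBl mulrBr addrA subrK.
by apply: JD; [apply: JMr; apply: repr_to_quot|apply: JM; apply: repr_to_quot].
Qed.

Let toq := to_quot_surj.

Lemma to_quotD x y : to_quot (x + y) = to_quot x + to_quot y.
Proof. by rewrite /to_quot raddfD. Qed.

Lemma quot_mulA : associative quot_mul.
Proof.
move=> x y z; have [a <-] := toq x; have [b <-] := toq y; have [c <-] := toq z.
by rewrite !quot_mulE mulrA.
Qed.
Lemma quot_mul1 : left_id quot_one quot_mul.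
Proof. by move=> x; have [a <-] := toq x; rewrite quot_mulE mul1r. Qed.
Lemma quot_1mul : right_id quot_one quot_mul.
Proof. by move=> x; have [a <-] := toq x; rewrite quot_mulE mulr1. Qed.
Lemma quot_mulDl : left_distributive quot_mul +%R.
Proof.
move=> x y z; have [a <-] := toq x; have [b <-] := toq y; have [c <-] := toq z.
by rewrite -to_quotD !quot_mulE mulrDl to_quotD.
Qed.
Lemma quot_mulDr : right_distributive quot_mul +%R.
Proof.
move=> x y z; have [a <-] := toq x; have [b <-] := toq y; have [c <-] := toq z.
by rewrite -to_quotD !quot_mulE mulrDr to_quotD.
Qed.

HB.instance Definition _ := GRing.Zmodule_isPzRing.Build ring_quot
  quot_mulA quot_mul1 quot_1mul quot_mulDl quot_mulDr.

HB.instance Definition _ := GRing.isZmodMorphism.Build R ring_quot to_quot to_quotB.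

Lemma to_quot_monoid : monoid_morphism to_quot.
Proof. by split=> // x y; rewrite -quot_mulE. Qed.

HB.instance Definition _ := GRing.isMonoidMorphism.Build R ring_quot to_quot
  to_quot_monoid.

End QuotientRing.

Record ore_set (R : pzRingType) := OreSet {
  ore_carrier :> set R;
  ore1 : ore_carrier 1;
  oreM : forall x y, ore_carrier x -> ore_carrier y -> ore_carrier (x * y);
  ore_regr : forall x r, ore_carrier x -> r * x = 0 -> r = 0;
  ore_regl : forall x r, ore_carrier x -> x * r = 0 -> r = 0;
  ore_cond : forall r x, ore_carrier x ->
    exists r' x', ore_carrier x' /\ r * x' = x * r' }.

(* [f : R -> S] is a right ring of fractions of [R] with respect to [X].  This
   is the defining property of R X^-1; [ore_loc_fractions] below shows that the
   ring constructed here has it. *)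
Definition is_right_fractions (R S : pzRingType) (X : set R) (f : R -> S) :=
  [/\ forall x, X x -> exists y, f x * y = 1 /\ y * f x = 1,
      forall z, exists r x y, [/\ X x, f x * y = 1, y * f x = 1 & z = f r * y] &
      forall r, f r = 0 <-> exists2 x, X x & r * x = 0].

(* The fraction r x^-1 is encoded by the graph of the largest partial right
   R-linear map a |-> r x^-1 a from R to R; the axioms below characterize the
   graphs obtained in this way. *)
Record ore_loc (R : pzRingType) (X : ore_set R) := OreLoc {
  graph : R -> R -> Prop;
  graphD : forall a b c d, graph a b -> graph c d -> graph (a + c) (b + d);
  graphM : forall a b r, graph a b -> graph (a * r) (b * r);
  graph_fun : forall b, graph 0 b -> b = 0;
  graph_dom : exists x b, ore_carrier X x /\ graph x b;
  graph_sat : forall a b y, ore_carrier X y -> graph (a * y) (b * y) ->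
    graph a b }.

Section OreLocalization.
Variables (R : pzRingType) (X : ore_set R).
Local Notation inX := (ore_carrier X).
Local Notation L := (ore_loc X).
Implicit Types F G H : L.

HB.instance Definition _ := gen_eqMixin L.
HB.instance Definition _ := gen_choiceMixin L.

Lemma graphN F a b : graph F a b -> graph F (- a) (- b).
Proof. by move=> h; rewrite -(mulrN1 a) -(mulrN1 b); apply: graphM. Qed.

Lemma graph_uniq F a b c : graph F a b -> graph F a c -> b = c.
Proof.
move=> h /graphN /(graphD h); rewrite subrr => /graph_fun /eqP.
by rewrite subr_eq0 => /eqP.
Qed.

Lemma graph_ext F G : (forall a b, graph F a b <-> graph G a b) -> F = G.
Proof.
case: F G => [g1 a1 a2 a3 a4 a5] [g2 b1 b2 b3 b4 b5] /= h.
have e : g1 = g2 by apply/funext=> a; apply/funext=> b; apply/propext.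
by subst g2; congr OreLoc; apply: Prop_irrelevance.
Qed.

Lemma graph_eq F G x b : inX x -> graph F x b -> graph G x b -> F = G.
Proof.
move=> Xx Fx Gx.
have sub (F1 F2 : L) : graph F1 x b -> graph F2 x b ->
    forall a c, graph F1 a c -> graph F2 a c.
  move=> F1x F2x a c F1a.
  have [r [y [Xy e]]] := ore_cond a Xx; apply: (graph_sat Xy).
  have := graphM y F1a; rewrite e => h.
  by rewrite (graph_uniq h (graphM r F1x)); apply: graphM.
by apply: graph_ext => a c; split; apply: sub.
Qed.

Lemma graph_def F b : exists y c, inX y /\ graph F (b * y) c.
Proof.
have [x [d [Xx Fx]]] := graph_dom F.
have [r [y [Xy e]]] := ore_cond b Xx.
by exists y, (d * r); split=> //; rewrite e; apply: graphM.
Qed.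

Lemma graph_def2 F G b :
  exists y c d, [/\ inX y, graph F (b * y) c & graph G (b * y) d].
Proof.
have [y [c [Xy Fy]]] := graph_def F b.
have [z [d [Xz Gz]]] := graph_def G (b * y).
exists (y * z), (c * z), d; rewrite mulrA; split=> //; first exact: oreM.
exact: graphM.
Qed.

Section Saturation.
Variable g : R -> R -> Prop.
Hypothesis gD : forall a b c d, g a b -> g c d -> g (a + c) (b + d).
Hypothesis gM : forall a b r, g a b -> g (a * r) (b * r).
Hypothesis gF : forall b, g 0 b -> b = 0.
Hypothesis gdom : exists x b, inX x /\ g x b.

Definition sat_rel a b := exists2 y, inX y & g (a * y) (b * y).

Lemma sat_relD a b c d : sat_rel a b -> sat_rel c d -> sat_rel (a + c) (b + d).
Proof.
move=> [y Xy gab] [z Xz gcd]; have [r [x [Xx e]]] := ore_cond y Xz.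
exists (y * x); first exact: oreM.
rewrite !mulrDl; apply: gD; first by rewrite !mulrA; apply: gM.
by rewrite e !mulrA; apply: gM.
Qed.

Lemma sat_relM a b r : sat_rel a b -> sat_rel (a * r) (b * r).
Proof.
move=> [y Xy gab]; have [s [x [Xx e]]] := ore_cond r Xy.
by exists x => //; rewrite -!mulrA e !mulrA; apply: gM.
Qed.

Lemma sat_rel_fun b : sat_rel 0 b -> b = 0.
Proof. by move=> [y Xy]; rewrite mul0r => /gF /(ore_regr Xy). Qed.

Lemma sat_rel_sub a b : g a b -> sat_rel a b.
Proof. by exists 1; [apply: ore1|rewrite !mulr1]. Qed.

Lemma sat_rel_dom : exists x b, inX x /\ sat_rel x b.
Proof. by have [x [b [Xx /sat_rel_sub]]] := gdom; exists x, b. Qed.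

Lemma sat_rel_sat a b y : inX y -> sat_rel (a * y) (b * y) -> sat_rel a b.
Proof.
move=> Xy [z Xz]; rewrite -!mulrA => h; exists (y * z) => //; exact: oreM.
Qed.

Definition saturate : L :=
  OreLoc sat_relD sat_relM sat_rel_fun sat_rel_dom sat_rel_sat.

End Saturation.

Section Scalar.
Variable r : R.
Definition frac_rel (a b : R) := b = r * a.
Lemma frac_relD a b c d :
  frac_rel a b -> frac_rel c d -> frac_rel (a + c) (b + d).
Proof. by rewrite /frac_rel => -> ->; rewrite mulrDr. Qed.
Lemma frac_relM a b s : frac_rel a b -> frac_rel (a * s) (b * s).
Proof. by rewrite /frac_rel => ->; rewrite mulrA. Qed.
Lemma frac_rel_fun b : frac_rel 0 b -> b = 0.
Proof. by rewrite /frac_rel mulr0. Qed.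
Lemma frac_rel_dom : exists x b, inX x /\ frac_rel x b.
Proof. by exists 1, r; split; [apply: ore1|rewrite /frac_rel mulr1]. Qed.
Lemma frac_rel_sat a b y : inX y -> frac_rel (a * y) (b * y) -> frac_rel a b.
Proof.
move=> Xy; rewrite /frac_rel mulrA => /eqP; rewrite -subr_eq0 -mulrBl => /eqP.
by move/(ore_regr Xy) => /eqP; rewrite subr_eq0 => /eqP.
Qed.
Definition to_loc : L :=
  OreLoc frac_relD frac_relM frac_rel_fun frac_rel_dom frac_rel_sat.
End Scalar.

Section Opp.
Variable F : L.
Definition opp_rel a b := graph F a (- b).
Lemma opp_relD a b c d : opp_rel a b -> opp_rel c d -> opp_rel (a + c) (b + d).
Proof. by rewrite /opp_rel opprD; apply: graphD. Qed.
Lemma opp_relM a b s : opp_rel a b -> opp_rel (a * s) (b * s).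
Proof. by rewrite /opp_rel -mulNr; apply: graphM. Qed.
Lemma opp_rel_fun b : opp_rel 0 b -> b = 0.
Proof. by move/graph_fun/eqP; rewrite oppr_eq0 => /eqP. Qed.
Lemma opp_rel_dom : exists x b, inX x /\ opp_rel x b.
Proof.
have [x [b [Xx Fx]]] := graph_dom F; exists x, (- b); split=> //.
by rewrite /opp_rel opprK.
Qed.
Lemma opp_rel_sat a b y : inX y -> opp_rel (a * y) (b * y) -> opp_rel a b.
Proof. by move=> Xy; rewrite /opp_rel -mulNr; apply: graph_sat. Qed.
Definition loc_opp : L :=
  OreLoc opp_relD opp_relM opp_rel_fun opp_rel_dom opp_rel_sat.
End Opp.

Section Add.
Variables F G : L.
Definition add_rel a b :=
  exists c d, [/\ graph F a c, graph G a d & b = c + d].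
Lemma add_relD a b c d : add_rel a b -> add_rel c d -> add_rel (a + c) (b + d).
Proof.
move=> [b1 [b2 [Fa Ga ->]]] [d1 [d2 [Fc Gc ->]]].
by exists (b1 + d1), (b2 + d2); split; [exact: graphD|exact: graphD|exact: addrACA].
Qed.
Lemma add_relM a b s : add_rel a b -> add_rel (a * s) (b * s).
Proof.
move=> [b1 [b2 [Fa Ga ->]]]; exists (b1 * s), (b2 * s).
by split; [exact: graphM|exact: graphM|exact: mulrDl].
Qed.
Lemma add_rel_fun b : add_rel 0 b -> b = 0.
Proof. by move=> [c [d [/graph_fun -> /graph_fun -> ->]]]; rewrite addr0. Qed.
Lemma add_rel_dom : exists x b, inX x /\ add_rel x b.
Proof.
have [y [c [d [Xy]]]] := graph_def2 F G 1; rewrite mul1r => Fy Gy.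
by exists y, (c + d); split=> //; exists c, d.
Qed.
Definition loc_add : L := saturate add_relD add_relM add_rel_fun add_rel_dom.
End Add.

Section Mul.
Variables F G : L.
Definition mul_rel a b := exists2 c, graph G a c & graph F c b.
Lemma mul_relD a b c d : mul_rel a b -> mul_rel c d -> mul_rel (a + c) (b + d).
Proof.
by move=> [e ? ?] [f ? ?]; exists (e + f); apply: graphD.
Qed.
Lemma mul_relM a b s : mul_rel a b -> mul_rel (a * s) (b * s).
Proof. by move=> [c ? ?]; exists (c * s); apply: graphM. Qed.
Lemma mul_rel_fun b : mul_rel 0 b -> b = 0.
Proof. by move=> [c /graph_fun -> /graph_fun]. Qed.
Lemma mul_rel_dom : exists x b, inX x /\ mul_rel x b.
Proof.
have [x [b [Xx Gx]]] := graph_dom G; have [y [c [Xy Fy]]] := graph_def F b.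
exists (x * y), c; split; first exact: oreM.
by exists (b * y) => //; apply: graphM.
Qed.
Definition loc_mul : L := saturate mul_relD mul_relM mul_rel_fun mul_rel_dom.
End Mul.

Lemma loc_addI F G a b c : graph F a b -> graph G a c ->
  graph (loc_add F G) a (b + c).
Proof. by move=> Fa Ga; apply: sat_rel_sub; exists b, c. Qed.

Lemma loc_mulI F G a b c : graph G a b -> graph F b c ->
  graph (loc_mul F G) a c.
Proof. by move=> Ga Fb; apply: sat_rel_sub; exists b. Qed.

Lemma to_locI r a : graph (to_loc r) a (r * a). Proof. by []. Qed.

Lemma loc_addA : associative loc_add.
Proof.
move=> F G H; have [y [b [c [Xy]]]] := graph_def2 F G 1; rewrite mul1r => Fy Gy.
have [z [d [Xz Hz]]] := graph_def H y.
move: (graphM z Fy) (graphM z Gy) => Fz Gz.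
apply: (graph_eq (oreM Xy Xz) (b := b * z + (c * z + d))).
  by apply: loc_addI => //; apply: loc_addI.
by rewrite addrA; apply: loc_addI => //; apply: loc_addI.
Qed.

Lemma loc_addC : commutative loc_add.
Proof.
move=> F G; have [y [b [c [Xy Fy Gy]]]] := graph_def2 F G 1.
rewrite mul1r in Fy Gy; apply: (graph_eq Xy (b := b + c)); first exact: loc_addI.
by rewrite addrC; apply: loc_addI.
Qed.

Lemma loc_add0 : left_id (to_loc 0) loc_add.
Proof.
move=> F; have [x [b [Xx Fx]]] := graph_dom F; apply: (graph_eq Xx) (Fx).
by have := loc_addI (to_locI 0 x) Fx; rewrite mul0r add0r.
Qed.

Lemma loc_addN : left_inverse (to_loc 0) loc_opp loc_add.
Proof.
move=> F; have [x [b [Xx Fx]]] := graph_dom F.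
apply: (graph_eq Xx (b := 0)); last by have := to_locI 0 x; rewrite mul0r.
by rewrite -(addNr b); apply: loc_addI => //=; rewrite /opp_rel opprK.
Qed.

HB.instance Definition _ := GRing.isZmodule.Build L
  loc_addA loc_addC loc_add0 loc_addN.

Lemma loc_mulA : associative loc_mul.
Proof.
move=> F G H; have [x [b [Xx Hx]]] := graph_dom H.
have [y [c [Xy Gy]]] := graph_def G b; have [z [d [Xz Fz]]] := graph_def F c.
have Hxyz := graphM z (graphM y Hx); have Gyz := graphM z Gy.
apply: (graph_eq (oreM (oreM Xx Xy) Xz) (b := d)).
  exact: loc_mulI (loc_mulI Hxyz Gyz) Fz.
exact: loc_mulI Hxyz (loc_mulI Gyz Fz).
Qed.

Lemma loc_mul1 : left_id (to_loc 1) loc_mul.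
Proof.
move=> F; have [x [b [Xx Fx]]] := graph_dom F; apply: (graph_eq Xx) (Fx).
by have := loc_mulI Fx (to_locI 1 b); rewrite mul1r.
Qed.

Lemma loc_1mul : right_id (to_loc 1) loc_mul.
Proof.
move=> F; have [x [b [Xx Fx]]] := graph_dom F; apply: (graph_eq Xx) (Fx).
by have := to_locI 1 x; rewrite mul1r => /loc_mulI; apply.
Qed.

Lemma loc_mulDl : left_distributive loc_mul loc_add.
Proof.
move=> F G H; have [x [b [Xx Hx]]] := graph_dom H.
have [y [c [d [Xy Fy Gy]]]] := graph_def2 F G b; have Hy := graphM y Hx.
apply: (graph_eq (oreM Xx Xy) (b := c + d)).
  exact: loc_mulI Hy (loc_addI Fy Gy).
exact: loc_addI (loc_mulI Hy Fy) (loc_mulI Hy Gy).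
Qed.

Lemma loc_mulDr : right_distributive loc_mul loc_add.
Proof.
move=> F G H; have [x [b [c [Xx]]]] := graph_def2 G H 1; rewrite mul1r => Gx Hx.
have [y [d [Xy Fy]]] := graph_def F b.
have [z [e [Xz Fz]]] := graph_def F (c * y).
have Gz := graphM z (graphM y Gx); have Hz := graphM z (graphM y Hx).
have Fz' := graphM z Fy.
apply: (graph_eq (oreM (oreM Xx Xy) Xz) (b := d * z + e)).
  by apply: loc_mulI (loc_addI Gz Hz) _; apply: graphD.
exact: loc_addI (loc_mulI Gz Fz') (loc_mulI Hz Fz).
Qed.

HB.instance Definition _ := GRing.Zmodule_isPzRing.Build L
  loc_mulA loc_mul1 loc_1mul loc_mulDl loc_mulDr.

Lemma to_loc1 r : graph (to_loc r) 1 r.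
Proof. by rewrite /= /frac_rel mulr1. Qed.

Lemma to_loc_zmod : zmod_morphism to_loc.
Proof.
move=> a b; apply: (graph_eq (ore1 X) (b := a - b)).
  exact: to_loc1.
apply: loc_addI; first exact: to_loc1.
by rewrite /= /opp_rel opprK; exact: to_loc1.
Qed.

HB.instance Definition _ := GRing.isZmodMorphism.Build R L to_loc to_loc_zmod.

Lemma to_loc_monoid : monoid_morphism to_loc.
Proof.
split=> // a b; apply: (graph_eq (ore1 X) (b := a * b)).
  exact: to_loc1.
exact: loc_mulI (to_loc1 b) (to_locI a b).
Qed.

HB.instance Definition _ := GRing.isMonoidMorphism.Build R L to_loc
  to_loc_monoid.

Section Inv.
Variables (x : R) (Xx : inX x).
Definition inv_rel a b := a = x * b.
Lemma inv_relD a b c d : inv_rel a b -> inv_rel c d -> inv_rel (a + c) (b + d).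
Proof. by rewrite /inv_rel => -> ->; rewrite mulrDr. Qed.
Lemma inv_relM a b s : inv_rel a b -> inv_rel (a * s) (b * s).
Proof. by rewrite /inv_rel => ->; rewrite mulrA. Qed.
Lemma inv_rel_fun b : inv_rel 0 b -> b = 0.
Proof. by move/esym/(ore_regl Xx). Qed.
Lemma inv_rel_dom : exists x b, inX x /\ inv_rel x b.
Proof. by exists x, 1; rewrite /inv_rel mulr1. Qed.
Definition loc_inv : L := saturate inv_relD inv_relM inv_rel_fun inv_rel_dom.

Lemma loc_invI : graph loc_inv x 1.
Proof. by apply: sat_rel_sub; rewrite /inv_rel mulr1. Qed.

Lemma loc_mulV : to_loc x * loc_inv = 1.
Proof.
apply: (graph_eq Xx (b := x)); last by have := to_locI 1 x; rewrite mul1r.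
exact: loc_mulI loc_invI (to_loc1 x).
Qed.

Lemma loc_mulVr : loc_inv * to_loc x = 1.
Proof.
apply: (graph_eq (ore1 X) (b := 1)); last exact: to_loc1.
exact: loc_mulI (to_loc1 x) loc_invI.
Qed.
End Inv.

Lemma ore_loc_fractions : is_right_fractions X to_loc.
Proof.
split=> [x Xx|F|r].
- by exists (loc_inv Xx); rewrite loc_mulV loc_mulVr.
- have [x [b [Xx Fx]]] := graph_dom F.
  exists b, x, (loc_inv Xx); rewrite loc_mulV loc_mulVr; split=> //.
  exact: (graph_eq Xx Fx (loc_mulI (loc_invI Xx) (to_loc1 b))).
- split=> [h|[x Xx rx0]]; last by rewrite (ore_regr Xx rx0) raddf0.
  exists 1; first exact: ore1.
  have := to_loc1 r; rewrite h => h1.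
  have := to_loc1 0; rewrite raddf0 => /(graph_uniq h1) ->; exact: mul0r.
Qed.

End OreLocalization.

(* The set I L of finite sums of products i l, for an ideal I of R. *)
Definition extend (R L : pzRingType) (f : R -> L) (I : set R) : set L :=
  [set z | exists m (a : 'I_m -> R) (l : 'I_m -> L),
     (forall i, I (a i)) /\ z = \sum_(i < m) f (a i) * l i].

Section Center.
Variable L : pzRingType.

Definition central : pred L := fun z => `[< forall y : L, z * y = y * z >].

Lemma central_subring : subring_closed central.
Proof.
split=> [|x y /asboolP hx /asboolP hy|x y /asboolP hx /asboolP hy];
  apply/asboolP => z; first by rewrite mul1r mulr1.
- by rewrite mulrBl mulrBr hx hy.
- by rewrite -mulrA hy mulrA hx mulrA.
Qed.

HB.instance Definition _ := GRing.isSubringClosed.Build L central central_subring.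

Record center := Center { center_val :> L; center_valP : center_val \in central }.

HB.instance Definition _ := [isSub for center_val].
HB.instance Definition _ := [Choice of center by <:].
HB.instance Definition _ := GRing.SubChoice_isSubPzRing.Build L central center central_subring.

Lemma center_mulC : commutative (@GRing.mul center).
Proof.
by move=> x y; apply: val_inj; rewrite !rmorphM; have /asboolP := center_valP x; apply.
Qed.

HB.instance Definition _ := GRing.PzSemiRing_hasCommutativeMul.Build center center_mulC.

End Center.

Definition is_domain (R : pzRingType) :=
  (1 : R) <> 0 /\ forall x y : R, x * y = 0 -> x = 0 \/ y = 0.

Definition noetherian (R : comPzRingType) :=
  forall I : nat -> set R, (forall m, is_ideal (I m)) ->
    (forall m, I m `<=` I m.+1) ->
    exists N, forall m, (N <= m)%N -> I m = I N.

Definition mult_antisym (k : fieldType) (n : nat) (q : 'M[k]_n) :=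
  (forall i, q i i = 1) /\
  (forall i j, q i j != 0 /\ q i j = (q j i)^-1).

Section Exponents.
Variable n : nat.
Local Notation expo := {ffun 'I_n -> nat}.
Implicit Types s t u : expo.

Definition expo_le s t := [forall i, s i <= t i]%N.

Definition expo_sub s t : expo := [ffun i => (s i - t i)%N].

(* The exponents t with t <= s componentwise, each listed once. *)
Definition below s : seq expo :=
  [seq [ffun i => nat_of_ord (f i)] | f : {dffun forall i : 'I_n, 'I_(s i).+1}].

Definition unit_expo (i : 'I_n) : expo := [ffun j => nat_of_bool (j == i)].

Lemma expo_leP s t : reflect (forall i, (s i <= t i)%N) (expo_le s t).
Proof. exact: forallP. Qed.

Lemma mem_below s t : (t \in below s) = expo_le t s.
Proof.
apply/mapP/expo_leP => [[f _ ->] i|h]; first by rewrite ffunE -ltnS ltn_ord.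
exists [ffun i => inord (t i) : 'I_(s i).+1]; first by rewrite mem_enum.
by apply/ffunP => i; rewrite !ffunE inordK // ltnS.
Qed.

Lemma uniq_below s : uniq (below s).
Proof.
rewrite map_inj_uniq ?enum_uniq // => f g /ffunP h; apply/ffunP => i.
by apply: val_inj; have := h i; rewrite !ffunE.
Qed.

Lemma expo_subK s t : expo_le t s -> t + expo_sub s t = s.
Proof. by move=> /expo_leP h; apply/ffunP => i; rewrite !ffunE; apply: subnKC. Qed.

Lemma expo_addK s t : expo_sub (s + t) s = t.
Proof. by apply/ffunP => i; rewrite !ffunE; apply: addKn. Qed.

Lemma expo_le_addr s t : expo_le s (s + t).
Proof. by apply/expo_leP => i; rewrite !ffunE; apply: leq_addr. Qed.

Lemma expo_addI s : injective (fun t : expo => s + t).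
Proof. by move=> t u /= h; rewrite -(expo_addK s t) h expo_addK. Qed.

Lemma expo_le_trans s t u : expo_le s t -> expo_le t u -> expo_le s u.
Proof.
by move=> /expo_leP h1 /expo_leP h2; apply/expo_leP => i; apply: leq_trans (h2 i).
Qed.

Lemma below_exchange (V : nmodType) s (F : expo -> expo -> V) :
  \sum_(r <- below s) \sum_(t <- below r) F t r =
  \sum_(t <- below s) \sum_(u <- below (expo_sub s t)) F t (t + u).
Proof.
have wid r : r \in below s ->
    \sum_(t <- below r) F t r = \sum_(t <- below s | expo_le t r) F t r.
  rewrite mem_below => hr; rewrite -[RHS]big_filter; apply: perm_big.
  apply: uniq_perm; rewrite ?filter_uniq ?uniq_below // => t.
  rewrite mem_filter !mem_below; apply/idP/andP => [h|[]//].
  by split=> //; apply: expo_le_trans hr.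
rewrite big_seq (eq_bigr _ wid) -big_seq (exchange_big_dep xpredT) //=.
rewrite big_seq [RHS]big_seq; apply: eq_bigr => t; rewrite mem_below => ht.
rewrite -big_filter -(big_map (fun u => t + u) xpredT (F t)).
apply: perm_big; apply: uniq_perm.
- by rewrite filter_uniq ?uniq_below.
- by rewrite map_inj_uniq ?uniq_below //; apply: expo_addI.
move=> r; rewrite mem_filter mem_below; apply/andP/mapP => [[h1 h2]|[u + ->]].
  exists (expo_sub r t); last by rewrite expo_subK.
  rewrite mem_below; apply/expo_leP => i; rewrite !ffunE.
  by apply: leq_sub2r; move/expo_leP: h2.
rewrite mem_below => /expo_leP hu; split; first exact: expo_le_addr.
apply/expo_leP => i; have := hu i; move/expo_leP/(_ i): ht; rewrite !ffunE => ht.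
by rewrite leq_subRL.
Qed.

End Exponents.

(* The series \sum_s c_s x^s is represented by its coefficient function. *)
Record qps (k : fieldType) (n : nat) (q : 'M[k]_n) := QPS {
  qcoef : {ffun 'I_n -> nat} -> k }.

Section SkewPowerSeries.
Variables (k : fieldType) (n : nat) (q : 'M[k]_n).
Local Notation expo := {ffun 'I_n -> nat}.
Local Notation R := (qps q).
Implicit Types (s t u : expo) (f g h : R).

HB.instance Definition _ := gen_eqMixin R.
HB.instance Definition _ := gen_choiceMixin R.

Lemma qpsP f g : qcoef f =1 qcoef g -> f = g.
Proof. by case: f g => [f] [g] /= /funext ->. Qed.

(* x^s x^t = qtwist s t x^(s + t): the factor q_ij arises each time some x_i
   moves past some x_j with j < i. *)
Definition qtwist s t : k :=
  \prod_(i < n) \prod_(j < n | (j < i)%N) q i j ^+ (s i * t j).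

Lemma qtwistDl s t u : qtwist (s + t) u = qtwist s u * qtwist t u.
Proof.
rewrite /qtwist -big_split; apply: eq_bigr => i _; rewrite -big_split.
by apply: eq_bigr => j _; rewrite ffunE mulnDl exprD.
Qed.

Lemma qtwistDr s t u : qtwist s (t + u) = qtwist s t * qtwist s u.
Proof.
rewrite /qtwist -big_split; apply: eq_bigr => i _; rewrite -big_split.
by apply: eq_bigr => j _; rewrite ffunE mulnDr exprD.
Qed.

Lemma qtwist0l s : qtwist 0 s = 1.
Proof.
by rewrite /qtwist big1 // => i _; rewrite big1 // => j _; rewrite ffunE expr0.
Qed.

Lemma qtwist0r s : qtwist s 0 = 1.
Proof.
rewrite /qtwist big1 // => i _; rewrite big1 // => j _.
by rewrite ffunE muln0 expr0.
Qed.

Definition qzero : R := QPS q (fun=> 0).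
Definition qopp f : R := QPS q (fun s => - qcoef f s).
Definition qadd f g : R := QPS q (fun s => qcoef f s + qcoef g s).
Definition qscale (a : k) f : R := QPS q (fun s => a * qcoef f s).
Definition qmono t : R := QPS q (fun s => (s == t)%:R).
Definition qmul f g : R := QPS q (fun s =>
  \sum_(t <- below s)
    qtwist t (expo_sub s t) * qcoef f t * qcoef g (expo_sub s t)).

Lemma qaddA : associative qadd.
Proof. by move=> f g h; apply: qpsP => s /=; rewrite addrA. Qed.
Lemma qaddC : commutative qadd.
Proof. by move=> f g; apply: qpsP => s /=; rewrite addrC. Qed.
Lemma qadd0 : left_id qzero qadd.
Proof. by move=> f; apply: qpsP => s /=; rewrite add0r. Qed.
Lemma qaddN : left_inverse qzero qopp qadd.
Proof. by move=> f; apply: qpsP => s /=; rewrite addNr. Qed.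

HB.instance Definition _ := GRing.isZmodule.Build R qaddA qaddC qadd0 qaddN.

Lemma qmul_monol f t s : qcoef (qmul (qmono t) f) s =
  if expo_le t s then qtwist t (expo_sub s t) * qcoef f (expo_sub s t) else 0.
Proof.
rewrite /=; case: ifP => h.
  rewrite (bigD1_seq t) ?mem_below ?uniq_below //= eqxx mulr1 big1 ?addr0 //.
  by move=> r /negPf ->; rewrite mulr0 mul0r.
rewrite big_seq big1 // => r; rewrite mem_below => hr.
by case: eqP => [e|_]; [rewrite -e hr in h|rewrite mulr0 mul0r].
Qed.

Lemma qmul_monor f t s : qcoef (qmul f (qmono t)) s =
  if expo_le t s then qtwist (expo_sub s t) t * qcoef f (expo_sub s t) else 0.
Proof.
have subK r u : expo_le r u -> expo_sub u (expo_sub u r) = r.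
  by move=> h; rewrite -{1}(expo_subK h) addrC expo_addK.
have subL r u : expo_le (expo_sub u r) u.
  by apply/expo_leP => i; rewrite ffunE leq_subr.
rewrite /=; case: ifP => h.
  rewrite (bigD1_seq (expo_sub s t)) ?mem_below ?uniq_below //=.
  rewrite subK // eqxx mulr1 big_seq_cond big1 ?addr0 // => r.
  rewrite mem_below => /andP[hr nr]; case: eqP => [e|_]; last by rewrite mulr0.
  by rewrite -e subK // eqxx in nr.
rewrite big_seq big1 // => r; rewrite mem_below => hr.
by case: eqP => [e|_]; [rewrite -e subL in h|rewrite mulr0].
Qed.

Lemma expo_le0 s : expo_le 0 s.
Proof. by apply/expo_leP => i; rewrite ffunE. Qed.

Lemma expo_sub0 s : expo_sub s 0 = s.
Proof. by apply/ffunP => i; rewrite !ffunE subn0. Qed.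

Lemma qmul1 : left_id (qmono 0) qmul.
Proof.
move=> f; apply: qpsP => s.
by rewrite qmul_monol expo_le0 expo_sub0 qtwist0l mul1r.
Qed.

Lemma q1mul : right_id (qmono 0) qmul.
Proof.
move=> f; apply: qpsP => s.
by rewrite qmul_monor expo_le0 expo_sub0 qtwist0r mul1r.
Qed.

Lemma qmulDl : left_distributive qmul +%R.
Proof.
move=> f g h; apply: qpsP => s /=; rewrite -big_split; apply: eq_bigr => t _ /=.
by rewrite mulrDr mulrDl.
Qed.

Lemma qmulDr : right_distributive qmul +%R.
Proof.
move=> f g h; apply: qpsP => s /=; rewrite -big_split; apply: eq_bigr => t _ /=.
by rewrite mulrDr.
Qed.

Lemma qmulA : associative qmul.
Proof.
move=> f g h; apply: qpsP => s /=; symmetry.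
under eq_bigr => r _ do rewrite big_distrr big_distrl /=.
rewrite (below_exchange s (fun t r => qtwist r (expo_sub s r) *
  (qtwist t (expo_sub r t) * qcoef f t * qcoef g (expo_sub r t)) *
  qcoef h (expo_sub s r))).
apply: eq_bigr => t _; rewrite big_distrr /= big_seq [RHS]big_seq.
apply: eq_bigr => u; rewrite mem_below => hu; rewrite expo_addK.
have -> : expo_sub s (t + u) = expo_sub (expo_sub s t) u.
  by apply/ffunP => i; rewrite !ffunE subnDA.
set v := expo_sub _ u; have -> : expo_sub s t = u + v by rewrite expo_subK.
rewrite qtwistDl qtwistDr; move: (qtwist t u) (qtwist t v) (qtwist u v).
move: (qcoef f t) (qcoef g u) (qcoef h v) => a b c x y z.
by ring.
Qed.

Lemma q1_neq0 : qmono 0 != 0 :> R.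
Proof.
apply/eqP => /(congr1 (fun f => qcoef f 0)) /= /eqP.
by rewrite eqxx oner_eq0.
Qed.

HB.instance Definition _ := GRing.Zmodule_isNzRing.Build R
  qmulA qmul1 q1mul qmulDl qmulDr q1_neq0.

Lemma qscaleA a b f : qscale a (qscale b f) = qscale (a * b) f.
Proof. by apply: qpsP => s /=; rewrite mulrA. Qed.
Lemma qscale1 : left_id 1 qscale.
Proof. by move=> f; apply: qpsP => s /=; rewrite mul1r. Qed.
Lemma qscaleDr : right_distributive qscale +%R.
Proof. by move=> a f g; apply: qpsP => s /=; rewrite mulrDr. Qed.
Lemma qscaleDl f : {morph qscale^~ f : a b / a + b}.
Proof. by move=> a b; apply: qpsP => s /=; rewrite mulrDl. Qed.

HB.instance Definition _ := GRing.Zmodule_isLmodule.Build k R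
  qscaleA qscale1 qscaleDr qscaleDl.

Lemma qscaleAl (a : k) f g : a *: (f * g) = (a *: f) * g.
Proof.
apply: qpsP => s /=; rewrite big_distrr; apply: eq_bigr => t _ /=.
by rewrite !mulrA (mulrC a).
Qed.

HB.instance Definition _ := GRing.Lmodule_isLalgebra.Build k R qscaleAl.

Lemma qscaleAr (a : k) f g : a *: (f * g) = f * (a *: g).
Proof.
apply: qpsP => s /=; rewrite big_distrr; apply: eq_bigr => t _ /=.
by rewrite mulrCA.
Qed.

HB.instance Definition _ := GRing.Lalgebra_isAlgebra.Build k R qscaleAr.

Definition qX (i : 'I_n) : R := qmono (unit_expo i).

Lemma qmonoM s t : qmono s * qmono t = qtwist s t *: qmono (s + t).
Proof.
apply: qpsP => r; rewrite qmul_monol /=; case: ifP => h.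
  have -> : (expo_sub r s == t) = (r == s + t).
    by apply/eqP/eqP => [<-|->]; rewrite ?expo_subK ?expo_addK.
  by case: eqP => [->|_]; rewrite ?mulr0 // expo_addK.
by case: eqP => [e|_]; rewrite ?mulr0 //; rewrite e expo_le_addr in h.
Qed.

Lemma qtwist_unit i j :
  qtwist (unit_expo i) (unit_expo j) = if (j < i)%N then q i j else 1.
Proof.
rewrite /qtwist (bigD1 i) //= [X in _ * X]big1 ?mulr1; last first.
  move=> l /negPf nl; rewrite big1 // => m _.
  by rewrite !ffunE nl mul0n expr0.
case: ifP => h.
  rewrite (bigD1 j) //= [X in _ * X]big1 ?mulr1.
    by rewrite !ffunE !eqxx mul1n expr1.
  by move=> l /andP[_ /negPf nl]; rewrite !ffunE nl muln0 expr0.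
rewrite big1 // => l hl; rewrite !ffunE eqxx mul1n; case: eqP => [e|_].
  by rewrite -e hl in h.
by rewrite expr0.
Qed.

Hypothesis hq : mult_antisym q.

Lemma qX_comm i j : qX i * qX j = q i j *: (qX j * qX i).
Proof.
rewrite !qmonoM addrC scalerA !qtwist_unit; congr (_ *: _).
case: hq => q1 q2; case: (ltngtP i j) => [h|h|/val_inj ->].
- by case: (q2 i j) => nz ->; rewrite mulVf //; case: (q2 j i).
- by rewrite mulr1.
- by rewrite q1 mulr1.
Qed.

End SkewPowerSeries.

Definition mult_gen (R : pzRingType) (S : set R) : set R :=
  [set x | forall M : set R, M 1 -> (forall a b, M a -> M b -> M (a * b)) ->
     S `<=` M -> M x].

Section Strata.
Variables (k : fieldType) (n : nat) (q : 'M[k]_n).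
Local Notation expo := {ffun 'I_n -> nat}.
Local Notation R := (qps q).
Implicit Types (s t u : expo) (f g h : R).

(* Indices 1..n of the variables are shifted to 'I_n = {0,..,n-1}. *)
Definition spec_w (w : {set 'I_n}) : set (spec R) :=
  [set P | forall i, prime_of P (qX q i) <-> i \in w].

Section W.
Variable w : {set 'I_n}.

Definition Jw : tsideal R :=
  TSIdeal (ideal_gen_ideal [set qX q i | i in [set` w]]).

Definition Rw : pzRingType := ring_quot Jw.

Definition Xw : set Rw :=
  mult_gen [set to_quot Jw (qX q i) | i in [set` ~: w]].

Definition off s := [forall i in w, s i == 0%N].

Lemma offP s : reflect (forall i, i \in w -> s i = 0%N) (off s).
Proof. by apply: (iffP forall_inP) => h i /h /eqP. Qed.

Lemma qcoef_sum (I : Type) (r : seq I) (P : pred I) (F : I -> R) s :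
  qcoef (\sum_(i <- r | P i) F i) s = \sum_(i <- r | P i) qcoef (F i) s.
Proof. by apply: (big_morph (fun f => qcoef f s)). Qed.

Lemma unit_expo_le i s : expo_le (unit_expo i) s = (s i != 0%N).
Proof.
apply/expo_leP/idP => [/(_ i)|h j]; rewrite ffunE ?eqxx -?lt0n //.
by case: eqP => [->|//]; rewrite lt0n.
Qed.

Lemma Jw_off f : tsideal_set Jw f -> forall s, off s -> qcoef f s = 0.
Proof.
move: f; apply: ideal_gen_sub; last first.
  move=> _ /= [i iw <-] s /offP so /=; case: eqP => // e.
  by have := so _ iw; rewrite e ffunE eqxx.
have offB s t : off s -> off (expo_sub s t).
  by move=> /offP h; apply/offP => i /h; rewrite ffunE => ->.
split=> //.
- by move=> f g hf hg s so /=; rewrite hf // hg // addr0.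
- move=> a f hf s so /=; rewrite big1 // => t _.
  by rewrite hf ?mulr0 //; apply: offB.
- move=> a f hf s so /=; rewrite big_seq big1 // => t.
  rewrite mem_below => /expo_leP ht; rewrite hf ?mulr0 ?mul0r //.
  apply/offP => i iw; apply/eqP; rewrite -leqn0; apply: leq_trans (ht i) _.
  by move/offP: so => ->.
Qed.

Hypothesis hq : mult_antisym q.

Lemma qtwist_neq0 s t : qtwist q s t != 0.
Proof.
apply/prodf_neq0 => i _; apply/prodf_neq0 => j _; apply: expf_neq0.
by case: hq => _ /(_ i j) [].
Qed.

Lemma off_Jw f : (forall s, off s -> qcoef f s = 0) -> tsideal_set Jw f.
Proof.
move=> hf; pose p s := [pick i | (i \in w) && (s i != 0%N)].
pose g i : R := QPS q (fun t => let s := t + unit_expo i in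
  if p s == Some i then (qtwist q (unit_expo i) t)^-1 * qcoef f s else 0).
have -> : f = \sum_(i in w) qX q i * g i.
  apply: qpsP => s; rewrite qcoef_sum.
  have e i : qcoef (qX q i * g i) s =
      if (s i != 0%N) && (p s == Some i) then qcoef f s else 0.
    rewrite qmul_monol unit_expo_le /=; case: ifP => //= si.
    rewrite addrC expo_subK ?unit_expo_le //; case: ifP => _; rewrite ?mulr0 //.
    by rewrite mulVKf // qtwist_neq0.
  under eq_bigr => i _ do rewrite e.
  rewrite /p; case: pickP => [i /andP[iw si]|no].
    rewrite (bigD1 i) //= si eqxx big1 ?addr0 // => j /andP[_ nj].
    by case: ifP => // /andP[_ /eqP [ej]]; rewrite ej eqxx in nj.
  rewrite big1 => [|i _]; last by rewrite andbF.
  by apply: hf; apply/offP => i iw; have := no i; rewrite iw => /negbT /negPn/eqP.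
have [J0 JD JM JMr] := tsidealP Jw.
apply: (big_ind (tsideal_set Jw)) => // i iw; apply: JMr.
by apply: sub_ideal_gen; exists i.
Qed.

Lemma off_unitD i s : i \notin w -> off s -> off (unit_expo i + s).
Proof.
move=> niw /offP so; apply/offP => j jw; rewrite !ffunE (so _ jw) addr0.
by case: eqP => // e; rewrite -e jw in niw.
Qed.

Lemma to_quot0 (f : R) : to_quot Jw f = 0 <-> tsideal_set Jw f.
Proof. by rewrite -(raddf0 (to_quot Jw)) to_quot_eq subr0. Qed.

Definition good (x : Rw) :=
  [/\ forall r, r * x = 0 -> r = 0, forall r, x * r = 0 -> r = 0 &
      forall r, exists r', r * x = x * r'].

Lemma Xw_good (x : Rw) : Xw x -> good x.
Proof.
move: x; move=> x; apply.
- split=> r; rewrite ?mulr1 ?mul1r //.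
  by exists r; rewrite mul1r.
- move=> a b [ar al an] [br bl bn]; split=> r.
  + by rewrite mulrA => /br /ar.
  + by rewrite -mulrA => /al /bl.
  + have [r1 e1] := an r; have [r2 e2] := bn r1.
    by exists r2; rewrite mulrA e1 -mulrA e2 mulrA.
- move=> _ /= [i iw <-]; have niw : i \notin w by move: iw; rewrite /= inE.
  split=> r; have [f <-] := to_quot_surj r.
  + rewrite -rmorphM => /to_quot0 h; apply/to_quot0; apply: off_Jw => s so.
    have := Jw_off h (off_unitD niw so).
    rewrite qmul_monor expo_le_addr expo_addK => /eqP.
    by rewrite mulf_eq0 (negPf (qtwist_neq0 _ _)) => /eqP.
  + rewrite -rmorphM => /to_quot0 h; apply/to_quot0; apply: off_Jw => s so.
    have := Jw_off h (off_unitD niw so).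
    rewrite qmul_monol expo_le_addr expo_addK => /eqP.
    by rewrite mulf_eq0 (negPf (qtwist_neq0 _ _)) => /eqP.
  + pose d := unit_expo i.
    pose g : R := QPS q (fun s => (qtwist q d s)^-1 * (qtwist q s d * qcoef f s)).
    exists (to_quot Jw g); rewrite -!rmorphM; congr to_quot.
    apply: qpsP => s; rewrite qmul_monol qmul_monor; case: ifP => // _ /=.
    by rewrite mulVKf // qtwist_neq0.
Qed.

Lemma Xw1 : Xw 1. Proof. by move=> M. Qed.

Lemma XwM (x y : Rw) : Xw x -> Xw y -> Xw (x * y).
Proof. by move=> hx hy M M1 MM SM; apply: (MM); [apply: hx|apply: hy]. Qed.

Lemma Xw_regr x r : Xw x -> r * x = 0 -> r = 0.
Proof. by move=> /Xw_good [+ _ _]; apply. Qed.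

Lemma Xw_regl x r : Xw x -> x * r = 0 -> r = 0.
Proof. by move=> /Xw_good [_ + _]; apply. Qed.

Lemma Xw_ore r x : Xw x -> exists r' x', Xw x' /\ r * x' = x * r'.
Proof. by move=> Xx; have [_ _ /(_ r) [r' e]] := Xw_good Xx; exists r', x. Qed.

Definition Xw_ore_set : ore_set Rw := OreSet Xw1 XwM Xw_regr Xw_regl Xw_ore.

Definition Lw : pzRingType := ore_loc Xw_ore_set.

Definition to_Lw (r : Rw) : Lw := to_loc Xw_ore_set r.

End W.
End Strata.

Arguments mult_antisym {k n} q.
Arguments spec_w {k n} q w.
Arguments Jw {k n} q w.
Arguments Rw {k n} q w.
Arguments Xw {k n} q w.
Arguments Xw_ore_set {k n q} w hq.
Arguments Lw {k n q} w hq.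
Arguments to_Lw {k n q} w hq r.

(* Main.v *)
(* Division by finitely many series with respect to the degree-lexicographic order
   shows, with Dickson's lemma, that two nested right ideals of R with the same
   leading exponents coincide. Hence R is right noetherian and its right ideals are
   closed in the adic topology. The noetherian property makes contraction along
   R -> L_w preserve primes, so Spec L_w is the set of primes containing J_w and
   avoiding the monomials in the x_i, i not in w, that is, Spec_w R.
   A two-sided ideal of L_w is stable under conjugation by monomials, so by
   closedness it contains the part of each of its elements supported on a single
   class of exponents with the same commutation characters. Dividing such a part by
   a monomial of its class gives a central element; thus every ideal of L_w is
   generated by its central elements. The projection of L_w onto the central
   exponents is Z_w-linear, so ideals of Z_w are recovered from their extensions.
   This gives Spec L_w = Spec Z_w and passes the noetherian property to Z_w. *)
Require Import Defs.
From mathcomp Require Import all_boot all_order all_algebra.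
From mathcomp Require Import all_classical topology.
From mathcomp Require Import ring.

Set Implicit Arguments.
Unset Strict Implicit.
Unset Printing Implicit Defensive.

Import GRing.Theory.

Local Open Scope classical_set_scope.
Local Open Scope ring_scope.

(** [F s] consults its functional argument only below [s]; the default [v0] makes the recursive call
    total and never affects the value. This yields the quotients in [division]. *)
Lemma wf_fixpoint (T V : Type) (v0 : V) (lt : T -> T -> Prop)
    (F : T -> (T -> V) -> V) : well_founded lt ->
  (forall s h1 h2, (forall t, lt t s -> h1 t = h2 t) -> F s h1 = F s h2) ->
  exists h, forall s, h s = F s h.
Proof.
move=> wf_lt F_ext.
pose G s (rec : forall t, lt t s -> V) :=
  F s (fun t => if pselect (lt t s) is left p then rec t p else v0).
exists (Fix wf_lt (fun=> V) G) => s; rewrite Fix_eq.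
  by apply: F_ext => t ts; case: pselect.
move=> t f g fg; apply: F_ext => u _; by case: pselect.
Qed.

(** * The degree-lexicographic order and Dickson's lemma *)

Section Exponents.
Variable n : nat.
Local Notation expo := {ffun 'I_n -> nat}.
Implicit Types s t u : expo.

Definition degree s := (\sum_i s i)%N.

(** Key 0 is the total degree and the later keys are the exponents, so deglex is the plain
    lexicographic order on [n + 1] keys. *)
Definition deglex_key s (i : 'I_n.+1) : nat :=
  if unlift ord0 i is Some j then s j else degree s.

Definition deglex_lt s t := exists i : 'I_n.+1,
  (forall j : 'I_n.+1, (j < i)%N -> deglex_key s j = deglex_key t j) /\
  (deglex_key s i < deglex_key t i)%N.

Lemma degreeD s t : degree (s + t) = (degree s + degree t)%N.
Proof. by rewrite -big_split; apply: eq_bigr => i _; rewrite ffunE. Qed.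

Lemma deglex_keyD s t i :
  deglex_key (s + t) i = (deglex_key s i + deglex_key t i)%N.
Proof. by rewrite /deglex_key; case: unliftP => [j|] _; rewrite ?ffunE ?degreeD. Qed.

Lemma deglex_key_inj s t : deglex_key s =1 deglex_key t -> s = t.
Proof.
by move=> h; apply/ffunP => i; have := h (lift ord0 i); rewrite /deglex_key liftK.
Qed.

Lemma deglex_degree s t : deglex_lt s t -> (degree s <= degree t)%N.
Proof.
have e u : deglex_key u ord0 = degree u by rewrite /deglex_key unlift_none.
case=> i [h1 h2]; rewrite -!e; case: (posnP i) => [i0|ip].
  by have -> : ord0 = i by [exact: val_inj]; exact: ltnW.
by rewrite h1.
Qed.

Lemma deglex_irr s : ~ deglex_lt s s.
Proof. by case=> i [_]; rewrite ltnn. Qed.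

Lemma deglex_trans s t u : deglex_lt s t -> deglex_lt t u -> deglex_lt s u.
Proof.
case=> i [hi1 hi2] [j [hj1 hj2]]; case: (ltngtP i j) => [ij|ji|/val_inj ij].
- exists i; split=> [l li|]; last by rewrite -(hj1 _ ij).
  by rewrite hi1 ?hj1 // (ltn_trans li).
- exists j; split=> [l li|]; last by rewrite (hi1 _ ji).
  by rewrite hi1 ?hj1 // (ltn_trans li).
- subst j; exists i; split=> [l li|]; last exact: ltn_trans hj2.
  by rewrite hi1 ?hj1.
Qed.

Lemma deglex_total s t : [\/ s = t, deglex_lt s t | deglex_lt t s].
Proof.
case: (pickP (fun i => deglex_key s i != deglex_key t i)) => [i0 hi0|h]; last first.
  by apply: Or31; apply: deglex_key_inj => i; apply/eqP/negPn/negbT/h.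
case: (arg_minnP (P := fun i => deglex_key s i != deglex_key t i)
  (fun i : 'I_n.+1 => nat_of_ord i) hi0) => i hi mi.
have eqi (j : 'I_n.+1) : (j < i)%N -> deglex_key s j = deglex_key t j.
  by move=> ji; apply/eqP/negPn/negP => /mi; rewrite leqNgt ji.
case: (ltngtP (deglex_key s i) (deglex_key t i)) hi => // h _.
- by apply: Or32; exists i.
- by apply: Or33; exists i; split=> // j /eqi ->.
Qed.

Lemma deglex_add2r s t u : deglex_lt s t -> deglex_lt (s + u) (t + u).
Proof.
case=> i [h1 h2]; exists i; split=> [j ji|]; rewrite !deglex_keyD ?ltn_add2r //.
by rewrite h1.
Qed.

(** The keys are minimized one after the other: at stage [m] the first [m] keys are
    lexicographically least, and among the elements sharing them the next key is minimized. *)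
Lemma deglex_min (A : set expo) : A !=set0 ->
  exists2 s, A s & forall t, A t -> t = s \/ deglex_lt s t.
Proof.
move=> A0.
have main m : (m <= n.+1)%N -> exists2 s, A s & forall t, A t ->
    (forall j : 'I_n.+1, (j < m)%N -> deglex_key t j = deglex_key s j) \/
    deglex_lt s t.
  elim: m => [_|m IH mn]; first by case: A0 => s As; exists s; [|left].
  have [s As smin] := IH (ltnW mn); pose i := Ordinal mn.
  pose B v := exists t, [/\ A t, v = deglex_key t i &
    forall j : 'I_n.+1, (j < m)%N -> deglex_key t j = deglex_key s j].
  have exB : exists v, `[< B v >] by exists (deglex_key s i); apply/asboolP; exists s.
  case: (ex_minnP exB) => v /asboolP [t [At -> te]] vmin.
  exists t => // u Au.
  have [ue|[j [jm h1 h2]]] : (forall j : 'I_n.+1, (j < m)%N ->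
      deglex_key u j = deglex_key s j) \/ exists j : 'I_n.+1, [/\ (j < m)%N,
      forall l : 'I_n.+1, (l < j)%N -> deglex_key s l = deglex_key u l &
      (deglex_key s j < deglex_key u j)%N].
    case: (smin u Au) => [|[j [h1 h2]]]; first by left.
    case: (ltnP j m) => jm; first by right; exists j.
    by left=> l lm; rewrite h1 // (leq_trans lm).
  - have : (deglex_key t i <= deglex_key u i)%N by apply: vmin; apply/asboolP; exists u.
    rewrite leq_eqVlt => /orP[/eqP e|lt_i]; last first.
      by right; exists i; split=> // j jm; rewrite te ?ue.
    left=> j; rewrite ltnS leq_eqVlt => /orP[/eqP jm|jm]; last by rewrite te ?ue.
    by have -> : j = i by [exact: val_inj].
  - right; exists j; split=> [l lj|]; last by rewrite te.
    by rewrite te ?h1 // (ltn_trans lj).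
have [s As smin] := main n.+1 (leqnn _).
exists s => // t /smin [e|]; [left|by right].
by apply: deglex_key_inj => j; apply: e.
Qed.

Lemma deglex_wf : well_founded deglex_lt.
Proof.
move=> s; apply: contrapT => nacc.
have [t nt tmin] := deglex_min (A := [set t | ~ Acc deglex_lt t]) (ex_intro _ s nacc).
apply: nt; constructor=> u ut; apply: contrapT => /tmin [e|tu].
  by apply: (@deglex_irr t); rewrite -{1}e.
exact: deglex_irr (deglex_trans ut tu).
Qed.

(** Induction on the number [m] of coordinates compared. If [B] works for the first [m] and [M]
    bounds coordinate [m] on [B], then [B] serves every [a] with [a i >= M]; the rest lies in the
    finitely many slices [a i = v], [v < M], each with its own finite set [C v]. *)
Lemma dickson (A : set expo) : exists B : seq expo,
  (forall b, b \in B -> A b) /\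
  (forall a, A a -> exists2 b, b \in B & expo_le b a).
Proof.
suff main m : (m <= n)%N -> forall A : set expo, exists B : seq expo,
    (forall b, b \in B -> A b) /\ (forall a, A a -> exists2 b, b \in B &
      forall i : 'I_n, (i < m)%N -> (b i <= a i)%N).
  have [B [BA h]] := main n (leqnn n) A; exists B; split=> // a /h [b bB hb].
  by exists b => //; apply/expo_leP => i; apply: hb.
elim: m => [_|m IH mn] {}A.
  have [[a Aa]|nA] := pselect (exists a, A a); last first.
    by exists [::]; split=> // a Aa; case: nA; exists a.
  exists [:: a]; split=> [b|b Ab]; first by rewrite inE => /eqP ->.
  by exists a; rewrite ?inE.
have [B [BA hB]] := IH (ltnW mn) A; pose i := Ordinal mn.
have [C hC] := choice (fun v => IH (ltnW mn) [set a | A a /\ a i = v]).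
pose M := (\max_(b <- B) b i)%N.
exists (B ++ flatten [seq C v | v <- iota 0 M]); split=> [b|a Aa].
  rewrite mem_cat => /orP[/BA //|/flatten_mapP [v _ bC]].
  by have [/(_ _ bC) []] := hC v.
have bnd (c : expo) : (forall j : 'I_n, (j < m)%N -> (c j <= a j)%N) -> (c i <= a i)%N ->
    forall j : 'I_n, (j < m.+1)%N -> (c j <= a j)%N.
  move=> h hi j; rewrite ltnS leq_eqVlt => /orP[/eqP jm|/h //].
  by have -> : j = i by [exact: val_inj].
case: (ltnP (a i) M) => aM.
  have [CA /(_ a) []// b bC ba] := hC (a i); exists b; last first.
    by apply: bnd => //; have [_ ->] := CA _ bC.
  rewrite mem_cat; apply/orP; right; apply/flatten_mapP; exists (a i) => //.
  by rewrite mem_iota.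
have [b bB ba] := hB a Aa; exists b; first by rewrite mem_cat bB.
by apply: bnd => //; apply: leq_trans aM; apply: leq_bigmax_seq.
Qed.

Lemma expo_sub_le s t : expo_le (expo_sub s t) s.
Proof. by apply/expo_leP => i; rewrite ffunE leq_subr. Qed.

Lemma expo_sub_sub s t : expo_le t s -> expo_sub s (expo_sub s t) = t.
Proof. by move=> h; rewrite -{1}(expo_subK h) addrC expo_addK. Qed.

Lemma big_below_sub (V : nmodType) s (F : expo -> V) :
  \sum_(t <- below s) F t = \sum_(t <- below s) F (expo_sub s t).
Proof.
rewrite -(big_map (expo_sub s) xpredT F); apply: perm_big; apply: uniq_perm.
- exact: uniq_below.
- rewrite map_inj_in_uniq ?uniq_below // => t u; rewrite !mem_below => ht hu e.
  by rewrite -(expo_sub_sub ht) e expo_sub_sub.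
move=> t; rewrite mem_below; apply/idP/mapP => [ht|[u _ ->]].
  by exists (expo_sub s t); rewrite ?mem_below ?expo_sub_le ?expo_sub_sub.
exact: expo_sub_le.
Qed.

End Exponents.

(** * Division with remainder and right ideals of the power series ring *)

Definition is_right_ideal (R : pzRingType) (I : set R) :=
  [/\ I 0, forall x y, I x -> I y -> I (x + y) & forall x a, I x -> I (x * a)].

Section RightIdeals.
Variables (k : fieldType) (n : nat) (q : 'M[k]_n).
Hypothesis hq : mult_antisym q.
Local Notation expo := {ffun 'I_n -> nat}.
Local Notation R := (qps q).
Implicit Types (s t u : expo) (f g h : R) (I K : set R).

Lemma qcoefD f g s : qcoef (f + g) s = qcoef f s + qcoef g s. Proof. by []. Qed.
Lemma qcoefB f g s : qcoef (f - g) s = qcoef f s - qcoef g s. Proof. by []. Qed.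
Lemma qcoefM f g s : qcoef (f * g) s =
  \sum_(t <- below s) qtwist q t (expo_sub s t) * qcoef f t * qcoef g (expo_sub s t).
Proof. by []. Qed.
Lemma qcoef_mulX f t s : qcoef (f * qmono q t) s =
  if expo_le t s then qtwist q (expo_sub s t) t * qcoef f (expo_sub s t) else 0.
Proof. exact: qmul_monor. Qed.
Lemma qcoef_Xmul f t s : qcoef (qmono q t * f) s =
  if expo_le t s then qtwist q t (expo_sub s t) * qcoef f (expo_sub s t) else 0.
Proof. exact: qmul_monol. Qed.

(** The deglex-smallest exponent of the support, since a series need not have a largest one. *)
Definition leading f s :=
  qcoef f s != 0 /\ forall t, deglex_lt t s -> qcoef f t = 0.

Lemma leading_ex f : f != 0 -> exists s, leading f s.
Proof.
move=> f0; have ne : [set s | qcoef f s != 0] !=set0.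
  apply: contrapT => no; case/eqP: f0; apply: qpsP => s; apply/eqP/negPn/negP => fs.
  by apply: no; exists s.
have [s fs smin] := deglex_min ne.
exists s; split=> // t ts; apply/eqP/negPn/negP => /smin [e|st].
  by rewrite e in ts; apply: deglex_irr ts.
exact: deglex_irr (deglex_trans ts st).
Qed.

Lemma leading_mulX f s t : leading f s -> leading (f * qmono q t) (s + t).
Proof.
move=> [fs fmin]; split=> [|u us]; rewrite qcoef_mulX.
  have -> : expo_le t (s + t) by rewrite addrC expo_le_addr.
  by rewrite addrC expo_addK mulf_neq0 // qtwist_neq0.
case: ifP => // tu; rewrite fmin ?mulr0 //.
have e : expo_sub u t + t = u by rewrite addrC expo_subK.
have [es|//|su] := deglex_total (expo_sub u t) s.
  by rewrite -es e in us; case: (deglex_irr us).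
by have := deglex_add2r t su; rewrite e => /(deglex_trans us) /deglex_irr.
Qed.

Definition initial I : set expo := [set s | exists2 f, I f & leading f s].

Lemma right_ideal_sum I (T : eqType) (r : seq T) (F : T -> R) : is_right_ideal I ->
  (forall i, i \in r -> I (F i)) -> I (\sum_(i <- r) F i).
Proof.
move=> [I0 ID _] h; rewrite big_seq; apply: (big_ind I) => //.
Qed.

(* Division by series with prescribed leading exponents: the coefficients of the
   quotients are found by deglex recursion. *)
Lemma division I (B : seq expo) f : is_right_ideal I ->
  (forall b, b \in B -> initial I b) ->
  exists2 h, I h & forall s b, b \in B -> expo_le b s -> qcoef (f - h) s = 0.
Proof.
move=> hI; wlog uB : B / uniq B => [hw|] BI.
  have [||h Ih hs] := hw (undup B); rewrite ?undup_uniq //.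
    by move=> b; rewrite mem_undup; apply: BI.
  by exists h => // s b bB; apply: hs; rewrite mem_undup.
have /choice [g hg] : forall b, exists g, b \in B -> I g /\ leading g b.
  move=> b; have [/BI [g]|_] := boolP (b \in B); first by exists g.
  by exists 0.
(* Each exponent [s] above some member of [B] is charged to the first such member, so that only one
   quotient is responsible for it. *)
pose idx s : expo := nth 0 B (find (fun b => expo_le b s) B).
have idxP s b : b \in B -> expo_le b s -> idx s \in B /\ expo_le (idx s) s.
  move=> bB bs; have h : has (fun b => expo_le b s) B by apply/hasP; exists b.
  by split; [rewrite mem_nth // -has_find|exact: (nth_find 0 h)].
pose Y (h : expo -> k) (b u : expo) := if idx (b + u) == b then h (b + u) else 0.
pose X (h : expo -> k) s (b t : expo) :=
  qtwist q t (expo_sub s t) * qcoef (g b) t * Y h b (expo_sub s t).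
pose low (h : expo -> k) s :=
  \sum_(b <- B) \sum_(t <- below s | `[< deglex_lt b t >]) X h s b t.
(* This solves the equation at [s] for [h s], which occurs only with [b = idx s] and [t = b]. Terms
   with [t] below [b] vanish, and those with [t] above [b], gathered in [low], use [h] at
   [b + (s - t)], which is smaller than [s]. *)
pose F s (h : expo -> k) :=
  (qtwist q (idx s) (expo_sub s (idx s)) * qcoef (g (idx s)) (idx s))^-1 *
  (qcoef f s - low h s).
have [|h hE] := @wf_fixpoint _ _ 0 _ F (@deglex_wf n).
  move=> s h1 h2 h12; congr (_ * (_ - _)); apply: eq_bigr => b _.
  rewrite big_seq_cond [RHS]big_seq_cond; apply: eq_bigr => t.
  rewrite mem_below => /andP[ts /asboolP bt]; congr (_ * _); rewrite /Y.
  case: ifP => // _; apply: h12; rewrite -{2}(expo_subK ts); exact: deglex_add2r.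
exists (\sum_(b <- B) g b * QPS q (Y h b)).
  case: (hI) => _ _ IM; apply: right_ideal_sum => // b /hg [Ig _]; exact: IM.
move=> s b bB bs; have [iB il] := idxP s b bB bs.
rewrite qcoefB qcoef_sum; apply/eqP; rewrite subr_eq0 eq_sym; apply/eqP.
have e c : c \in B -> qcoef (g c * QPS q (Y h c)) s =
    \sum_(t <- below s | `[< deglex_lt c t >]) X h s c t +
    (if c == idx s then X h s c c else 0).
  move=> cB; rewrite qcoefM (bigID (fun t => `[< deglex_lt c t >])) /=; congr (_ + _).
  have [_ [_ gmin]] := hg c cB.
  have z t : t != c -> ~~ `[< deglex_lt c t >] -> qcoef (g c) t = 0.
    move=> tc /asboolP ct; apply: gmin.
    by have [e|//|//] := deglex_total t c; rewrite e eqxx in tc.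
  have [cs|ncs] := boolP (expo_le c s).
    rewrite big_mkcond (bigD1_seq c) ?mem_below ?uniq_below //= big1 ?addr0.
      case: ifP => [_|/negbT/negPn/asboolP/deglex_irr //].
      by rewrite /X /Y expo_subK // eq_sym; case: ifP => // _; rewrite mulr0.
    by move=> t tc; case: ifP => // /z ->; rewrite ?mulr0 ?mul0r.
  rewrite big_seq_cond big1; last first.
    move=> t /andP[]; rewrite mem_below => ts /z ->; rewrite ?mulr0 ?mul0r //.
    by apply: contraNneq ncs => <-.
  by case: eqP => // ec; rewrite ec il in ncs.
rewrite big_seq (eq_bigr _ e) -big_seq big_split /= -/(low h s).
rewrite (bigD1_seq (idx s)) //= eqxx big1 ?addr0 => [|c /negPf -> //].
rewrite /X /Y expo_subK // eqxx [h s]hE /F mulVKf.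
  by rewrite addrC subrK.
by rewrite mulf_neq0 ?qtwist_neq0 //; case: (hg _ iB) => _ [].
Qed.

(** Divide [f] by elements of [K] whose leading exponents generate [initial K]. A nonzero remainder
    lies in [I], so its leading exponent lies above some [b] in [B], where division left only zero
    coefficients. *)
Lemma right_ideal_sub I K : is_right_ideal I -> is_right_ideal K -> K `<=` I ->
  initial I `<=` initial K -> I `<=` K.
Proof.
move=> hI hK KI IK f If; have [B [BK hB]] := dickson (initial K).
have [h Kh hs] := division f hK BK.
suff e : f - h = 0 by move/eqP: e; rewrite subr_eq0 => /eqP ->.
apply/eqP/negPn/negP => /leading_ex [s ls].
have /IK /hB [b bB bs] : initial I s.
  exists (f - h) => //; case: hI => _ ID IM; apply: ID => //.
  by rewrite -mulrN1; apply: IM; apply: KI.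
by case: ls; rewrite (hs s b) ?eqxx.
Qed.

Lemma initial_up I s t : is_right_ideal I -> initial I s -> expo_le s t -> initial I t.
Proof.
move=> [_ _ IM] [f If ls] /expo_subK <-; exists (f * qmono q (expo_sub t s)).
  exact: IM.
exact: leading_mulX.
Qed.

(** Dickson generators of the union of the initial sets all appear at a finite stage; from there on
    the initial sets, hence the ideals, are constant. *)
Lemma right_noetherian_qps (I : nat -> set R) : (forall m, is_right_ideal (I m)) ->
  (forall m, I m `<=` I m.+1) -> exists N, forall m, (N <= m)%N -> I m = I N.
Proof.
move=> hI Iinc.
have Imono m p : (m <= p)%N -> I m `<=` I p.
  by move/subnK <-; elim: (p - m)%N => // l IH f /IH; apply: Iinc.
have [B [BU hB]] := dickson (\bigcup_m initial (I m)).
have /choice [d hd] : forall b, exists m, b \in B -> initial (I m) b.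
  move=> b; have [/BU [m _ bm]|_] := boolP (b \in B); first by exists m.
  by exists 0%N.
exists (\max_(b <- B) d b)%N => m Nm; apply/seteqP; split; last exact: Imono.
apply: right_ideal_sub => //; first exact: Imono.
move=> s Ims; have [b bB bs] : exists2 b, b \in B & expo_le b s.
  by apply: hB; exists m.
apply: initial_up bs => //; have [f If lf] := hd b bB; exists f => //.
by apply: Imono If; apply: leq_bigmax_seq.
Qed.

Lemma right_ideal_closed I f : is_right_ideal I ->
  (forall N, exists2 g, I g & forall s, (degree s <= N)%N -> qcoef g s = qcoef f s) ->
  I f.
Proof.
move=> hI hf; have [I0 ID IM] := hI.
(* The adic closure [C] is a right ideal with no new leading exponents: agreement up to the degree
   of [s] covers every exponent deglex-below [s]. *)
pose C : set R := [set f | forall N, exists2 g, I g &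
  forall s, (degree s <= N)%N -> qcoef g s = qcoef f s].
suff : C `<=` I by apply.
apply: right_ideal_sub => //.
- split=> [N|x y hx hy N|x a hx N]; first by exists 0.
    have [[g Ig eg] [g' Ig' eg']] := (hx N, hy N); exists (g + g'); first exact: ID.
    by move=> s sN; rewrite !qcoefD eg ?eg'.
  have [g Ig eg] := hx N; exists (g * a); first exact: IM.
  move=> s sN; rewrite !qcoefM big_seq [RHS]big_seq; apply: eq_bigr => t.
  rewrite mem_below => ts; rewrite eg //; apply: leq_trans sN.
  by apply: leq_sum => i _; move/expo_leP: ts.
- by move=> g Ig N; exists g.
- move=> s [g Cg [gs gmin]]; have [h Ih he] := Cg (degree s); exists h => //.
  split=> [|t ts]; first by rewrite he.
  by rewrite he ?gmin //; apply: deglex_degree.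
Qed.

End RightIdeals.

(** * One-sided ideals and the elementwise form of primeness *)

Section Ideals.
Variable R : pzRingType.
Implicit Types (I J P : set R).

Lemma ideal_right I : is_ideal I -> is_right_ideal I.
Proof. by move=> [I0 ID _ IM]; split=> // x a; apply: IM. Qed.

Lemma right_idealN I x : is_right_ideal I -> I x -> I (- x).
Proof. by move=> [_ _ IM] Ix; rewrite -mulrN1; apply: IM. Qed.

Lemma right_idealB I x y : is_right_ideal I -> I x -> I y -> I (x - y).
Proof. by move=> hI Ix Iy; have [_ ID _] := hI; apply: ID => //; apply: right_idealN. Qed.

(** The sets [J] of [y] with [a R y] in [P] and [I] of [x] with [x R J] in [P] are two-sided ideals
    with [I J] in [P], and they contain [b] and [a] respectively. *)
Lemma prime_ideal_elt P a b : prime_ideal P -> (forall r, P (a * r * b)) -> P a \/ P b.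
Proof.
move=> [[P0 PD PM PMr] _ hP] hab.
pose J := [set y | forall r, P (a * r * y)].
pose I := [set x | forall r y, J y -> P (x * r * y)].
have hJ : is_ideal J.
  split=> [r|x y Jx Jy r|s x Jx r|s x Jx r]; rewrite /= ?mulr0 //.
  - by rewrite mulrDr; apply: PD.
  - by have := Jx (r * s); rewrite !mulrA.
  - by rewrite mulrA; apply: PMr.
have hI : is_ideal I.
  split=> [r y _|x y Ix Iy r z Jz|s x Ix r y Jy|s x Ix r y Jy]; rewrite /= ?mul0r //.
  - by rewrite !mulrDl; apply: PD; [apply: Ix|apply: Iy].
  - by rewrite -!mulrA; apply: PM; rewrite mulrA; apply: Ix.
  - by have := Ix (s * r) y Jy; rewrite !mulrA.
have [x y Ix Jy|sub|sub] := hP I J hI hJ.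
- by have := Ix 1 y Jy; rewrite mulr1.
- by left; apply: sub => r y; apply.
- by right; apply: sub.
Qed.

Lemma prime_ideal_neq1 P : prime_ideal P -> ~ P 1.
Proof.
move=> [[_ _ PM _] PT _] P1; apply: PT; apply/seteqP; split=> // x _.
by rewrite -(mulr1 x); apply: PM.
Qed.

Lemma spec_inj (P Q : spec R) : prime_of P = prime_of Q -> P = Q.
Proof.
case: P Q => [P hP] [Q hQ] /= e; subst Q; congr Spec; exact: Prop_irrelevance.
Qed.

End Ideals.

(** * Continuity criteria for spectra and subspaces *)

Section Topology.

Lemma continuous_spec (X : topologicalType) (R : pzRingType) (f : X -> spec R) :
  (forall I, is_ideal I -> open (f @^-1` (~` Vset I))) -> continuous f.
Proof. by move=> h; apply/continuousP => _ [I hI ->]; apply: h. Qed.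

Lemma open_compl_Vset (R : pzRingType) (I : set R) : is_ideal I -> open (~` Vset I).
Proof. by move=> hI; exists I. Qed.

Lemma open_set_type (X : topologicalType) (A : set X) (U : set X) :
  open U -> open ((@set_val X A) @^-1` U).
Proof. by move=> oU; exists U. Qed.

Lemma continuous_set_type (X Y : topologicalType) (A : set Y) (f : X -> set_type A) :
  (forall U, open U -> open ((fun x => set_val (f x)) @^-1` U)) -> continuous f.
Proof. by move=> h; apply/continuousP => _ [U oU <-]; apply: (h U). Qed.

Lemma homeomorphic_trans (X Y Z : topologicalType) (f : X -> Y) :
  is_homeomorphism f -> homeomorphic Y Z -> homeomorphic X Z.
Proof.
move=> [g [fK gK cf cg]] [f' [g' [fK' gK' cf' cg']]]; exists (f' \o f), (g \o g').
split; [exact: can_comp|exact: can_comp| |].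
- by move=> x; apply: continuous_comp; [exact: cf|exact: cf'].
- by move=> x; apply: continuous_comp; [exact: cg'|exact: cg].
Qed.

End Topology.

(** * Extension of ideals along a map *)

Section Extension.
Variables (R L : pzRingType) (f : R -> L) (I : set R).

Lemma extendMl a l : I a -> extend f I (f a * l).
Proof.
by move=> Ia; exists 1%N, (fun=> a), (fun=> l); split=> //; rewrite big_ord1.
Qed.

Lemma extend_right_ideal : is_right_ideal (extend f I).
Proof.
split=> [|x y|x c].
- by exists 0%N, (fun=> 0), (fun=> 0); rewrite big_ord0; split=> // -[].
- move=> [m [a [l [Ia ->]]]] [p [b [l' [Ib ->]]]].
  exists (m + p)%N, (fun i => match fintype.split i with inl j => a j | inr j => b j end),
    (fun i => match fintype.split i with inl j => l j | inr j => l' j end).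
  split=> [i|]; first by case: fintype.split.
  rewrite big_split_ord; congr (_ + _); apply: eq_bigr => i _.
    by rewrite -[lshift _ _]/(unsplit (inl i)) unsplitK.
  by rewrite -[rshift _ _]/(unsplit (inr i)) unsplitK.
- move=> [m [a [l [Ia ->]]]]; exists m, a, (fun i => l i * c); split=> //.
  by rewrite big_distrl; apply: eq_bigr => i _; rewrite /= mulrA.
Qed.

Lemma extend_sub (K : set L) : is_right_ideal K -> (forall a, I a -> K (f a)) ->
  extend f I `<=` K.
Proof.
move=> [K0 KD KM] h _ [m [a [l [Ia ->]]]]; apply: (big_ind K) => // i _.
by apply: KM; apply: h.
Qed.

End Extension.

Lemma extendS (R L : pzRingType) (f : R -> L) (I J : set R) :
  I `<=` J -> extend f I `<=` extend f J.
Proof.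
move=> IJ; apply: extend_sub; first exact: extend_right_ideal.
by move=> a /IJ Ja; rewrite -(mulr1 (f a)); apply: extendMl.
Qed.

Lemma extend_image (R S L : pzRingType) (f : S -> L) (g : R -> S) (I : set R) :
  extend f (g @` I) = extend (f \o g) I.
Proof.
apply/seteqP; split; apply: extend_sub; try exact: extend_right_ideal.
  by move=> _ [a Ia <-]; rewrite -(mulr1 (f _)); apply: (extendMl (f \o g)).
by move=> a Ia; rewrite -(mulr1 (_ a)); apply: extendMl; exists a.
Qed.

(** * Primes under localization at normal elements *)

(* [phi] is a quotient map followed by a localization, so it need not be
   injective; the contraction of a prime of [L] is then a prime containing its
   kernel. *)
Section Localization.
Variables (R L : pzRingType) (phi : {rmorphism R -> L}) (S : set R).
Hypothesis SM : forall x y, S x -> S y -> S (x * y).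
Hypothesis Sinv : forall x, S x -> exists y, phi x * y = 1 /\ y * phi x = 1.
Hypothesis Snormr : forall x r, S x -> exists r', r * x = x * r'.
Hypothesis Snorml : forall x r, S x -> exists r', x * r = r' * x.
Hypothesis fracP : forall z, exists x r, S x /\ z * phi x = phi r.
Hypothesis acc : forall I : nat -> set R, (forall m, is_right_ideal (I m)) ->
  (forall m, I m `<=` I m.+1) -> exists N, forall m, (N <= m)%N -> I m = I N.
Implicit Types (P : set R) (Q : set L).

(** [P] contains the kernel of [phi] and the elements of [S] are regular on both sides modulo [P]:
    these are the ideals recovered from their extension. *)
Definition saturated P :=
  [/\ forall r, phi r = 0 -> P r, forall x r, S x -> P (r * x) -> P r &
      forall x r, S x -> P (x * r) -> P r].

Lemma contraction_ideal Q : is_ideal Q -> is_ideal (phi @^-1` Q).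
Proof.
move=> [Q0 QD QM QMr]; split=> [|x y|a x|a x] /=; first by rewrite rmorph0.
- by rewrite rmorphD; apply: QD.
- by rewrite rmorphM; apply: QM.
- by rewrite rmorphM; apply: QMr.
Qed.

Lemma contraction_right_ideal Q : is_right_ideal Q -> is_right_ideal (phi @^-1` Q).
Proof.
move=> [Q0 QD QM]; split=> [|x y|x a] /=; first by rewrite rmorph0.
- by rewrite rmorphD; apply: QD.
- by rewrite rmorphM; apply: QM.
Qed.

Lemma right_ideal_frac Q z x r : is_right_ideal Q -> S x -> z * phi x = phi r ->
  Q z <-> Q (phi r).
Proof.
move=> [_ _ QM] Sx e; split=> [Qz|]; rewrite -e; first exact: QM.
by have [y [xy _]] := Sinv Sx; move/(QM _ y); rewrite -mulrA xy mulr1.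
Qed.

(** Every [z] is some [phi r] times a unit, so a right ideal of [L] is determined by its
    contraction. *)
Lemma sub_of_contraction Q Q' : is_right_ideal Q -> is_right_ideal Q' ->
  phi @^-1` Q `<=` phi @^-1` Q' -> Q `<=` Q'.
Proof.
move=> hQ hQ' sub z Qz; have [x [r [Sx e]]] := fracP z.
apply/(right_ideal_frac hQ' Sx e); apply: sub.
exact/(right_ideal_frac hQ Sx e).
Qed.

(* An ideal of [R] need not be stable under conjugation by [x]; the noetherian
   hypothesis repairs this for quotients [Q : I]. *)
Lemma annihilator_normal Q (I : set R) x b : is_right_ideal Q -> is_ideal I -> S x ->
  (forall a, I a -> Q (phi (a * x * b))) -> forall a, I a -> Q (phi (a * b)).
Proof.
move=> hQ [_ _ IM IMr] Sx hb a Ia; have [Q0 QD QM] := hQ.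
(* The [K m] ascend because [I x] lies in [I]. Writing [b x^N = x^N b'], the hypothesis puts [b'] in
   [K N.+1 = K N]; hence [a b x^N] maps into [Q], and the image of [x] can be cancelled. *)
pose K m := [set c | forall a, I a -> Q (phi (a * x ^+ m * c))].
have hK m : is_right_ideal (K m).
  split=> [u Iu|c d Kc Kd u Iu|c d Kc u Iu]; rewrite /= ?mulr0 ?rmorph0 //.
    by rewrite mulrDr rmorphD; apply: QD; [apply: Kc|apply: Kd].
  by rewrite mulrA rmorphM; apply: QM; apply: Kc.
have [|N hN] := acc hK.
  by move=> m c Kc u Iu; rewrite exprS mulrA; apply: Kc; apply: IMr.
have normX m c : exists c', c * x ^+ m = x ^+ m * c'.
  elim: m c => [|m IH] c; first by exists c; rewrite mulr1 mul1r.
  have [c1 e1] := IH c; have [c2 e2] := Snormr c1 Sx; exists c2.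
  by rewrite exprSr mulrA e1 -mulrA e2 mulrA.
have [b' eb] := normX N b.
have : K N.+1 b'.
  move=> u Iu; rewrite exprS -!mulrA -eb !mulrA rmorphM; apply: QM; exact: hb.
rewrite hN // => /(_ a Ia); rewrite -mulrA -eb mulrA rmorphM rmorphXn.
have [y [xy _]] := Sinv Sx; elim: N {hN eb} => [|N IH]; first by rewrite mulr1.
by move/(QM _ y); rewrite exprSr -!mulrA xy mulr1.
Qed.

(** For [z = r x^-1] and [b x = x b'] one has [a z b = a r b' x^-1] in [L]. Since [I x b' = I b x]
    maps into [Q], [annihilator_normal] puts [a r b'] there, and the elementwise form of primeness
    applies. *)
Lemma contraction_prime Q : prime_ideal Q -> prime_ideal (phi @^-1` Q).
Proof.
move=> hQ; have [Qid QT Qpr] := hQ; have Qr := ideal_right Qid.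
split; first exact: contraction_ideal.
  move=> e; apply: (prime_ideal_neq1 hQ); rewrite -(rmorph1 phi).
  by have : (phi @^-1` Q) 1 by rewrite e.
move=> I J hI hJ IJ.
have key a b : I a -> J b -> Q (phi a) \/ Q (phi b).
  move=> Ia Jb; apply: prime_ideal_elt => // z.
  have [x [r [Sx e]]] := fracP z; have [b' eb] := Snormr b Sx.
  have h : Q (phi (a * r * b')).
    apply: (annihilator_normal Qr hI Sx) => [u Iu|]; last by case: hI => _ _ _; apply.
    rewrite -mulrA -eb mulrA rmorphM; case: (Qr) => _ _; apply.
    by apply: IJ => //; case: hI.
  have [y [xy yx]] := Sinv Sx; have [_ _ QM] := Qr.
  have -> : phi a * z * phi b = phi (a * r * b') * y; last exact: QM.
  have -> : z = phi r * y by rewrite -e -mulrA xy mulr1.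
  rewrite !rmorphM -!mulrA; congr (_ * (_ * _)).
  rewrite -[LHS]mulr1 -xy -!mulrA; rewrite (mulrA (phi b)) -rmorphM eb rmorphM.
  by rewrite !mulrA yx mul1r.
have [IQ|nIQ] := pselect (I `<=` phi @^-1` Q); [by left|right=> b Jb].
move/existsNP: nIQ => [a /not_implyP [Ia nQa]].
by have [] := key a b Ia Jb.
Qed.

Lemma contraction_saturated Q : is_ideal Q -> saturated (phi @^-1` Q).
Proof.
move=> [Q0 QD QM QMr]; split=> [r /= ->//|x r Sx|x r Sx] /=; rewrite rmorphM;
  have [y [xy yx]] := Sinv Sx.
- by move/(QMr y); rewrite -mulrA xy mulr1.
- by move/(QM y); rewrite mulrA yx mul1r.
Qed.

Lemma contraction_disjoint Q x : prime_ideal Q -> S x -> ~ Q (phi x).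
Proof.
move=> hQ Sx Qx; have [[_ _ _ QM] _ _] := hQ; have [y [xy _]] := Sinv Sx.
by apply: (prime_ideal_neq1 hQ); rewrite -xy; apply: QM.
Qed.

(** Normality of [x] turns [r x] in [P] into [r R x] inside [P], and [x] is not in [P]; likewise on
    the other side. *)
Lemma prime_saturated P : prime_ideal P -> (forall r, phi r = 0 -> P r) ->
  (forall x, S x -> ~ P x) -> saturated P.
Proof.
move=> hP kP SP; have [[_ _ PM PMr] _ _] := hP.
split=> // x r Sx h.
- have [s|//|/SP []//] := prime_ideal_elt (a := r) (b := x) hP _.
  have [s' e] := Snormr s Sx; rewrite -mulrA e mulrA; exact: PMr.
- have [s|/SP []//|//] := prime_ideal_elt (a := x) (b := r) hP _.
  have [s' ->] := Snorml s Sx; rewrite -mulrA; exact: PM.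
Qed.

Section Extended.
Variable P : set R.
Hypotheses (hP : is_ideal P) (sP : saturated P).

(** Normal denominators can be made common, so a finite sum in the extension collapses to one
    fraction with numerator in [P]. *)
Lemma extendE :
  extend phi P = [set z | exists x r, [/\ S x, P r & z * phi x = phi r]].
Proof.
have [[P0 PD PM PMr] [kP Pr Pl]] := (hP, sP).
apply/seteqP; split=> [|z [x [r [Sx Px e]]]]; last first.
  have [y [xy _]] := Sinv Sx; rewrite -(mulr1 z) -xy mulrA e; exact: extendMl.
have [x0 [_ [Sx0 _]]] := fracP 0.
apply: extend_sub => [|a Pa]; last first.
  by exists x0, (a * x0); rewrite rmorphM; split=> //; apply: PMr.
split=> [|z z' [x [r [Sx Prr e]]] [x' [r' [Sx' Pr' e']]]|z l [x [r [Sx Prr e]]]].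
- by exists x0, 0; rewrite mul0r rmorph0.
- have [u eu] := Snormr x Sx'; exists (x * x'), (r * x' + r' * u).
  split; [exact: SM|by apply: PD; apply: PMr|].
  by rewrite mulrDl {2}eu !rmorphD !rmorphM !mulrA e e'.
- have [x' [g [Sx' e']]] := fracP l; have [g' eg] := Snormr g Sx.
  exists (x' * x), (r * g'); split; [exact: SM|exact: PMr|].
  by rewrite rmorphM mulrA -(mulrA z) e' -mulrA -rmorphM eg !rmorphM mulrA e.
Qed.

Lemma extend_contraction : phi @^-1` (extend phi P) = P.
Proof.
have [[P0 PD PM PMr] [kP Pr Pl]] := (hP, sP).
rewrite extendE; apply/seteqP; split=> r /=.
  move=> [x [s [Sx Ps e]]]; apply: (Pr x) => //; rewrite -(subrK s (r * x)).
  by apply: PD => //; apply: kP; rewrite rmorphB rmorphM e subrr.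
have [x [_ [Sx _]]] := fracP 0 => Prr.
by exists x, (r * x); rewrite rmorphM; split=> //; apply: PMr.
Qed.

Lemma extend_ideal : is_ideal (extend phi P).
Proof.
have [E0 ED EM] := extend_right_ideal phi P.
have [[P0 PD PM PMr] [kP Pr Pl]] := (hP, sP).
split=> // [l z|l z Ez]; last exact: EM.
rewrite extendE => -[x [r [Sx Prr e]]].
(* Moving [x'^-1] past [r] replaces [r] by [r'] with [r x' = x' r']; saturation on the left keeps
   [r'] in [P]. *)
have [x' [g [Sx' e']]] := fracP l; have [r' er] := Snormr r Sx'.
exists (x * x'), (g * r'); split; first exact: SM.
  by apply: PM; apply: (Pl x') => //; rewrite -er; apply: PMr.
by rewrite rmorphM mulrA -(mulrA l) e -mulrA -rmorphM er !rmorphM mulrA e'.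
Qed.

Lemma extend_prime : prime_ideal P -> prime_ideal (extend phi P).
Proof.
move=> [_ PT Ppr]; split; first exact: extend_ideal.
  by move=> e; apply: PT; rewrite -extend_contraction e.
move=> I J hI hJ IJ; have hE := ideal_right extend_ideal.
have [a b Ia Jb|sub|sub] := Ppr _ _ (contraction_ideal hI) (contraction_ideal hJ).
- by rewrite -extend_contraction /= rmorphM; apply: IJ.
- left; apply: sub_of_contraction; rewrite ?extend_contraction //; exact: ideal_right.
- right; apply: sub_of_contraction; rewrite ?extend_contraction //; exact: ideal_right.
Qed.

End Extended.

Lemma contraction_extend Q : is_ideal Q -> extend phi (phi @^-1` Q) = Q.
Proof.
move=> hQ; have hE := extend_right_ideal phi (phi @^-1` Q).
have e := extend_contraction (contraction_ideal hQ) (contraction_saturated hQ).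
have hQr := ideal_right hQ.
by apply/seteqP; split; apply: sub_of_contraction => //; rewrite e.
Qed.

Lemma localization_homeomorphism (A : set (spec R)) :
  (forall P : spec R, A P <->
    (forall r, phi r = 0 -> prime_of P r) /\ (forall x, S x -> ~ prime_of P x)) ->
  exists Theta : set_type A -> spec L, is_homeomorphism Theta /\
    forall P : set_type A, prime_of (Theta P) = extend phi (prime_of (set_val P)).
Proof.
move=> hA.
have idP (P : spec R) : is_ideal P by case: (prime_ofP P).
have satP (P : set_type A) : saturated (prime_of (set_val P)).
  have /hA [kP SP] := set_valP P; exact: prime_saturated (prime_ofP _) kP SP.
pose Theta (P : set_type A) :=
  Spec (extend_prime (idP (set_val P)) (satP P) (prime_ofP (set_val P))).
have conA (Q : spec L) : A (Spec (contraction_prime (prime_ofP Q))).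
  apply/hA; split=> [r /= ->|x /= Sx]; first by case: (prime_ofP Q) => -[].
  exact: contraction_disjoint (prime_ofP Q) Sx.
pose Psi (Q : spec L) : set_type A := SigSub (mem_set (conA Q)).
have PsiE (Q : spec L) : prime_of (set_val (Psi Q)) = phi @^-1` (prime_of Q) by [].
exists Theta; split=> //; exists Psi; split.
- move=> P; apply: val_inj; apply: spec_inj; rewrite PsiE.
  exact: extend_contraction.
- move=> Q; apply: spec_inj; rewrite /= contraction_extend //.
  by case: (prime_ofP Q).
- apply: continuous_spec => I hI.
  have -> : Theta @^-1` (~` Vset I) = set_val @^-1` (~` Vset (phi @^-1` I)).
    have hIr := ideal_right hI.
    apply/seteqP; split=> P /= nI sub; apply: nI => z.
      apply: sub_of_contraction => //; first exact: extend_right_ideal.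
      by rewrite extend_contraction.
    by move=> Iz; rewrite -(extend_contraction (idP _) (satP P)); apply: sub.
  by apply: open_set_type; apply: open_compl_Vset; apply: contraction_ideal.
- apply: continuous_set_type => _ [I hI ->].
  have -> : (fun Q : spec L => set_val (Psi Q)) @^-1` (~` Vset I) =
      ~` Vset (ideal_gen (phi @` I)).
    apply/seteqP; split=> Q /= nI sub; apply: nI.
      by move=> r Ir; apply: sub; apply: sub_ideal_gen; exists r.
    by apply: ideal_gen_sub => [|_ [r Ir <-]]; [case: (prime_ofP Q)|apply: sub].
  by apply: open_compl_Vset; apply: ideal_gen_ideal.
Qed.

Lemma localization_domain : (forall a b, phi (a * b) = 0 -> phi a = 0 \/ phi b = 0) ->
  (1 : L) <> 0 -> is_domain L.
Proof.
move=> dom L1; split=> // z z'.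
have [[x [r [Sx e]]] [x' [r' [Sx' e']]]] := (fracP z, fracP z').
have [r2 er] := Snormr r' Sx; have [[y [xy yx]] [y' [xy' _]]] := (Sinv Sx, Sinv Sx').
have zE u v (v' : R) w : S v -> phi v * w = 1 -> u * phi v = phi v' -> phi v' = 0 -> u = 0.
  by move=> _ vw uv v0; rewrite -(mulr1 u) -vw mulrA uv v0 mul0r.
move=> zz'; have : phi (r * r2) = 0.
  by rewrite rmorphM -e -mulrA -rmorphM -er rmorphM -e' !mulrA zz' !mul0r.
case/dom => [r0|r20]; [left; exact: (zE _ _ _ _ Sx xy e r0)|right].
apply: (zE _ _ _ _ Sx' xy' e'); rewrite -(mulr1 (phi r')) -xy mulrA -rmorphM er rmorphM r20.
by rewrite mulr0 mul0r.
Qed.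

End Localization.

(** * Rings whose ideals correspond to those of the center *)

Section CenterSpec.
Variable L : pzRingType.
Local Notation Z := (center L).
Local Notation ext := (extend (@center_val L)).
Hypothesis gen_central : forall I : set L, is_ideal I -> I `<=` ext (@center_val L @^-1` I).
Hypothesis ext_central : forall (a : set Z) z, is_ideal a -> ext a (center_val z) -> a z.

Lemma centerC (z : Z) (l : L) : center_val z * l = l * center_val z.
Proof. by have /asboolP := center_valP z; apply. Qed.

Lemma center_ideal (I : set L) : is_ideal I -> is_ideal (@center_val L @^-1` I).
Proof.
move=> [I0 ID IM IMr]; split=> [|x y|c x|c x] //=.
- exact: ID.
- exact: IM.
- exact: IMr.
Qed.

Lemma ext_ideal (a : set Z) : is_ideal a -> is_ideal (ext a).
Proof.
have [E0 ED EM] := extend_right_ideal (@center_val L) a.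
move=> ha; split=> // [c _ [m [b [l [ab ->]]]]|c z Ez]; last exact: EM.
rewrite big_distrr; apply: (big_ind (ext a)) => // i _.
by rewrite /= mulrA -centerC -mulrA; apply: extendMl.
Qed.

Lemma ext_center_val (a : set Z) : is_ideal a -> @center_val L @^-1` (ext a) = a.
Proof.
move=> ha; apply/seteqP; split=> z /=; first exact: ext_central.
by move=> az; rewrite -(mulr1 (center_val z)); apply: extendMl.
Qed.

Lemma ext_of_center (I : set L) : is_ideal I -> ext (@center_val L @^-1` I) = I.
Proof.
move=> hI; apply/seteqP; split; last exact: gen_central.
by apply: extend_sub => //; apply: ideal_right.
Qed.

Lemma center_val_prime (Q : set L) : prime_ideal Q -> prime_ideal (@center_val L @^-1` Q).
Proof.
move=> [hQ QT Qpr]; split; first exact: center_ideal.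
  by move=> e; apply: QT; rewrite -(ext_of_center hQ) e (ext_of_center (@is_idealT _)).
move=> a b ha hb ab; have [_ QD QM QMr] := hQ.
have [|sub|sub] := Qpr _ _ (ext_ideal ha) (ext_ideal hb).
- move=> x _ [m [c [l [ac ->]]]] [m' [d [l' [bd ->]]]].
  (* Central factors move together: each term [c l d l'] equals [c d l l'], with [c d] in [Q]. *)
  rewrite big_distrl; apply: (big_ind Q) => [||i _]; rewrite ?big_distrr; try by case: hQ.
  apply: (big_ind Q) => [||j _]; try by case: hQ.
  rewrite /= -mulrA (mulrA (l i)) -centerC !mulrA; apply/QMr/QMr.
  exact: (ab (c i) (d j)).
- by left=> z az; apply: sub; rewrite -(mulr1 (center_val z)); apply: extendMl.
- by right=> z az; apply: sub; rewrite -(mulr1 (center_val z)); apply: extendMl.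
Qed.

Lemma ext_prime (a : set Z) : prime_ideal a -> prime_ideal (ext a).
Proof.
move=> [ha aT apr]; split; first exact: ext_ideal.
  by move=> e; apply: aT; rewrite -(ext_center_val ha) e.
move=> I J hI hJ IJ.
have [x y Ix Jy|sub|sub] := apr _ _ (center_ideal hI) (center_ideal hJ).
- by rewrite -(ext_center_val ha); apply: IJ.
- by left; rewrite -(ext_of_center hI); apply: extendS.
- by right; rewrite -(ext_of_center hJ); apply: extendS.
Qed.

Lemma spec_center_homeomorphic : homeomorphic (spec L) (spec Z).
Proof.
exists (fun Q => Spec (center_val_prime (prime_ofP Q))).
exists (fun a => Spec (ext_prime (prime_ofP a))).
have idP (R : pzRingType) (P : spec R) : is_ideal P by case: (prime_ofP P).
split.
- by move=> Q; apply: spec_inj; apply: ext_of_center.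
- by move=> a; apply: spec_inj; apply: ext_center_val.
- apply: continuous_spec => a ha.
  suff -> : (fun Q => Spec (center_val_prime (prime_ofP Q))) @^-1` (~` Vset a) =
    ~` Vset (ext a) by apply: open_compl_Vset; apply: ext_ideal.
  apply/seteqP; split=> Q /= na sub; apply: na.
    by rewrite -(ext_center_val ha) => z; apply: sub.
  by move=> z; rewrite -(ext_of_center (idP _ Q)); apply: extendS.
- apply: continuous_spec => I hI.
  suff -> : (fun a => Spec (ext_prime (prime_ofP a))) @^-1` (~` Vset I) =
    ~` Vset (@center_val L @^-1` I) by apply: open_compl_Vset; apply: center_ideal.
  apply/seteqP; split=> a /= nI sub; apply: nI.
    by rewrite -(ext_of_center hI); apply: extendS.
  by move=> z; rewrite -(ext_center_val (idP _ a)); apply: sub.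
Qed.

End CenterSpec.

(** * Monomials and [L_w] as a localization of [R] *)

Lemma expo_unit_ind (n : nat) (A : {ffun 'I_n -> nat} -> Prop) :
  A 0 -> (forall i s, A s -> A (unit_expo i + s)) -> forall s, A s.
Proof.
move=> A0 AS s; elim: {s}(degree s) {-2}s (erefl (degree s)) => [|m IH] s ds.
  have -> : s = 0; last by [].
  apply/ffunP => i; rewrite ffunE; apply/eqP; rewrite -leqn0 -ds /degree.
  by rewrite (bigD1 i) //= leq_addr.
have [i si|s0] := pickP (fun i => s i != 0%N); last first.
  by move: ds; rewrite /degree big1 // => i _; apply/eqP/negPn/negbT/s0.
have e : unit_expo i + expo_sub s (unit_expo i) = s.
  by apply: expo_subK; rewrite unit_expo_le.
rewrite -e; apply: AS; apply: IH; move: ds; rewrite -{1}e degreeD.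
have -> : degree (unit_expo i) = 1%N; last by move=> [].
rewrite /degree (bigD1 i) //= ffunE eqxx big1 ?addn0 // => j /negPf ji.
by rewrite ffunE ji.
Qed.

Section Stratum.
Variables (k : fieldType) (n : nat) (q : 'M[k]_n).
Hypothesis hq : mult_antisym q.
Variable w : {set 'I_n}.
Local Notation expo := {ffun 'I_n -> nat}.
Local Notation R := (qps q).
Local Notation L := (Lw w hq).
Local Notation X := (qmono q).
Implicit Types (s t u v : expo) (f g h r : R) (z l p : L).

(** The composite [R -> R/J_w -> L_w], treated as one localization with kernel [J_w], so that
    division in [R] can be used directly. *)
Definition to_stratum : {rmorphism R -> L} :=
  GRing.RMorphism.clone R L (to_loc (Xw_ore_set w hq) \o to_quot (Jw q w)) _.
Local Notation phi := to_stratum.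

Lemma to_stratum0 f : phi f = 0 <-> tsideal_set (Jw q w) f.
Proof.
rewrite -to_quot0; split=> [|h]; last first.
  by rewrite -[LHS]/(to_loc (Xw_ore_set w hq) (to_quot (Jw q w) f)) h rmorph0.
have [_ _ hf] := ore_loc_fractions (Xw_ore_set w hq).
by move/hf => [x Xx /(Xw_regr hq Xx)].
Qed.

Lemma to_stratum_eq0 f : phi f = 0 <-> forall s, off w s -> qcoef f s = 0.
Proof.
by rewrite to_stratum0; split=> [|h]; [exact: Jw_off|exact: (off_Jw hq)].
Qed.

Lemma to_stratum_eq f g :
  (forall s, off w s -> qcoef f s = qcoef g s) -> phi f = phi g.
Proof.
move=> e; apply/eqP; rewrite -subr_eq0 -rmorphB; apply/eqP/to_stratum_eq0 => s so.
by rewrite qcoefB e ?subrr.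
Qed.

Lemma off0 : off w (0 : expo).
Proof. by apply/offP => i _; rewrite ffunE. Qed.

Lemma offD s t : off w (s + t) = off w s && off w t.
Proof.
apply/offP/andP => [h|[/offP hs /offP ht] i iw]; last by rewrite ffunE hs ?ht.
by split; apply/offP => i /h; rewrite ffunE => /eqP; rewrite addn_eq0 => /andP[/eqP ? /eqP ?].
Qed.

Lemma off_unit i : off w (unit_expo i) = (i \notin w).
Proof.
apply/offP/idP => [h|iw j jw].
  by apply/negP => /h; rewrite ffunE eqxx.
by rewrite ffunE; case: eqP => // e; rewrite -e jw in iw.
Qed.

Lemma off_sub s t : off w s -> off w (expo_sub s t).
Proof. by move=> /offP h; apply/offP => i /h; rewrite ffunE => ->. Qed.

Lemma scaleM1 (c : k) f : f * (c *: 1) = c *: f.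
Proof. by rewrite -qscaleAr mulr1. Qed.

Lemma scale1C (c : k) f : (c *: 1) * f = f * (c *: 1).
Proof. by rewrite scaleM1 -scalerAl mul1r. Qed.

Lemma X0 : X 0 = 1. Proof. by []. Qed.

Lemma XD s t : X (s + t) = (qtwist q s t)^-1 *: (X s * X t).
Proof. by rewrite qmonoM scalerA mulVf ?scale1r ?qtwist_neq0. Qed.

Lemma XM s t : X s * X t = qtwist q s t *: X (s + t).
Proof. exact: qmonoM. Qed.

Lemma phiZ_unit (c : k) : c != 0 ->
  phi (c *: 1) * phi (c^-1 *: 1) = 1 /\ phi (c^-1 *: 1) * phi (c *: 1) = 1.
Proof.
by move=> c0; rewrite -!rmorphM !scaleM1 !scalerA mulVf // mulfV // scale1r rmorph1.
Qed.

Lemma phiX_unit s : off w s -> exists y, phi (X s) * y = 1 /\ y * phi (X s) = 1.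
Proof.
elim/expo_unit_ind: s => [_|i s IH]; first by exists 1; rewrite X0 rmorph1 mulr1.
rewrite offD off_unit => /andP[iw /IH [y [xy yx]]].
have Xi : Xw q w (to_quot (Jw q w) (X (unit_expo i))).
  by move=> M _ _; apply; exists i => //=; rewrite inE.
have [/(_ _ Xi) [a [xa ax]] _ _] := ore_loc_fractions (Xw_ore_set w hq).
rewrite -[to_loc _ _]/(phi (X (unit_expo i))) in xa ax.
have c0 : (qtwist q (unit_expo i) s)^-1 != 0 by rewrite invr_eq0 qtwist_neq0.
have [Vc cV] := phiZ_unit c0; set c := _^-1 in c0 Vc cV.
have ec : phi (X (unit_expo i + s)) = phi (X (unit_expo i)) * phi (X s) * phi (c *: 1).
  by rewrite -!rmorphM scaleM1 XD.
exists (phi (c^-1 *: 1) * (y * a)); rewrite ec; split.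
  by rewrite -!mulrA (mulrA (phi (c *: 1))) Vc mul1r (mulrA _ y) xy mul1r.
by rewrite !mulrA -(mulrA _ a) ax mulr1 -(mulrA _ y) yx mulr1.
Qed.

Lemma Xw_monomial x : Xw q w x ->
  exists c s, [/\ c != 0, off w s & x = to_quot (Jw q w) (c *: X s)].
Proof.
move/(_ [set x | exists c s, [/\ c != 0, off w s & x = to_quot (Jw q w) (c *: X s)]]).
apply=> [|_ _ [c [s [c0 so ->]]] [d [t [d0 to ->]]]|_ [i iw <-]] /=.
- by exists 1, 0; rewrite oner_eq0 off0 scale1r rmorph1.
- exists (c * d * qtwist q s t), (s + t); rewrite !mulf_neq0 ?qtwist_neq0 //.
  by rewrite offD so to -rmorphM -scalerAl -scalerAr XM !scalerA.
- exists 1, (unit_expo i); rewrite oner_eq0 off_unit scale1r; split=> //.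
  by move: iw; rewrite /= inE.
Qed.

Lemma stratum_frac z : exists s r, off w s /\ z * phi (X s) = phi r.
Proof.
have [_ /(_ z) [r [x [y [/Xw_monomial [c [s [c0 so ->]]] xy yx ->]]]] _] :=
  ore_loc_fractions (Xw_ore_set w hq).
have [f <-] := to_quot_surj r; exists s, (f * (c^-1 *: 1)); split=> //.
rewrite -[to_loc _ _]/(phi f) rmorphM -mulrA; congr (_ * _).
rewrite -[to_loc _ _]/(phi (c *: X s)) in yx.
have -> : X s = (c *: X s) * (c^-1 *: 1) by rewrite scaleM1 scalerA mulVf // scale1r.
by rewrite rmorphM mulrA yx mul1r.
Qed.

(** Nonzero scalars are included because a product of monomials is a monomial only up to a twist. *)
Definition denominators : set R :=
  [set x | exists c s, [/\ c != 0, off w s & x = c *: X s]].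

Lemma denominatorsX s : off w s -> denominators (X s).
Proof. by exists 1, s; rewrite oner_eq0 scale1r. Qed.

Lemma denominatorsM x y : denominators x -> denominators y -> denominators (x * y).
Proof.
move=> [c [s [c0 so ->]]] [d [t [d0 to ->]]].
exists (c * d * qtwist q s t), (s + t); rewrite !mulf_neq0 ?qtwist_neq0 //.
by rewrite offD so to -scalerAl -scalerAr XM !scalerA.
Qed.

Lemma denominators_unit x : denominators x -> exists y, phi x * y = 1 /\ y * phi x = 1.
Proof.
move=> [c [s [c0 /phiX_unit [y [xy yx]] ->]]]; have [Vc cV] := phiZ_unit c0.
exists (y * phi (c^-1 *: 1)).
have -> : c *: X s = (c *: 1) * X s by rewrite scale1C scaleM1.
by rewrite rmorphM -mulrA (mulrA _ y) xy mul1r -mulrA (mulrA _ (phi (c *: 1))) cV mul1r.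
Qed.

(* [x^u x^s = commutation u s *: x^s x^u] *)
Definition commutation u s := qtwist q u s / qtwist q s u.

Lemma commutation_neq0 u s : commutation u s != 0.
Proof. by rewrite mulf_neq0 ?invr_eq0 ?qtwist_neq0. Qed.

Lemma commutationD u s t : commutation u (s + t) = commutation u s * commutation u t.
Proof. by rewrite /commutation qtwistDl qtwistDr invfM mulrACA. Qed.

(** For [c = commutation u] this is conjugation by [x^u], as [X_hadamard] shows. *)
Definition hadamard (c : expo -> k) f : R := QPS q (fun s => c s * qcoef f s).

Lemma X_hadamard u f : X u * f = hadamard (commutation u) f * X u.
Proof.
apply: qpsP => v; rewrite qcoef_Xmul qcoef_mulX; case: ifP => // _ /=.
by rewrite mulrA (mulrC (qtwist q _ u)) divfK ?qtwist_neq0.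
Qed.

Lemma hadamard_X u f : f * X u = X u * hadamard (fun s => (commutation u s)^-1) f.
Proof.
apply: qpsP => v; rewrite qcoef_Xmul qcoef_mulX; case: ifP => // _ /=.
by rewrite /commutation invf_div mulrA (mulrC (qtwist q u _)) divfK ?qtwist_neq0.
Qed.

Lemma denominators_normr x r : denominators x -> exists r', r * x = x * r'.
Proof.
move=> [c [s [_ _ ->]]]; exists (hadamard (fun t => (commutation s t)^-1) r).
by rewrite -scalerAr hadamard_X scalerAl.
Qed.

Lemma denominators_norml x r : denominators x -> exists r', x * r = r' * x.
Proof.
move=> [c [s [_ _ ->]]]; exists (hadamard (commutation s) r).
by rewrite -scalerAl X_hadamard scalerAr.
Qed.

Lemma denominators_frac z : exists x r, denominators x /\ z * phi x = phi r.
Proof.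
have [s [r [so e]]] := stratum_frac z; exists (X s), r; split=> //.
exact: denominatorsX.
Qed.

Lemma to_stratum_domain f g : phi (f * g) = 0 -> phi f = 0 \/ phi g = 0.
Proof.
have lead h : phi h <> 0 -> exists s, [/\ off w s, qcoef h s != 0 &
    forall t, off w t -> deglex_lt t s -> qcoef h t = 0].
  move=> h0; have ne : [set s | off w s /\ qcoef h s != 0] !=set0.
    apply: contrapT => no; apply/h0/to_stratum_eq0 => s so.
    by apply/eqP/negPn/negP => hs; apply: no; exists s.
  have [s [so hs] smin] := deglex_min ne; exists s; split=> // t to ts.
  apply/eqP/negPn/negP => ht; case: (smin t) => // [e|st].
    by rewrite e in ts; case: (deglex_irr ts).
  exact: deglex_irr (deglex_trans ts st).
move=> fg0; apply: contrapT => /not_orP [/lead [s [so fs smin]] /lead [t [to gt tmin]]].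
move/to_stratum_eq0: fg0 => /(_ (s + t)); rewrite offD so to => /(_ isT).
(* For any other splitting [u + v = s + t], either [u] is below [s] or [v] is below [t], so the only
   surviving term is the product of the two least ones. *)
rewrite qcoefM (bigD1_seq s) ?mem_below ?uniq_below ?expo_le_addr //= expo_addK.
rewrite big_seq_cond big1 ?addr0 => [|u].
  by apply/eqP; rewrite !mulf_neq0 ?qtwist_neq0.
rewrite mem_below => /andP[us nus].
have := expo_subK us; set v := expo_sub _ u => uv.
have /andP[uo vo] : off w u && off w v by rewrite -offD uv offD so.
have [e|us'|su] := deglex_total u s; first by rewrite e eqxx in nus.
  by rewrite smin // mulr0 mul0r.
have [e|vt|tv] := deglex_total v t; last 1 first.
- have := deglex_trans (deglex_add2r t su) _; rewrite -uv ![u + _]addrC.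
  by move/(_ _ (deglex_add2r u tv)) => /deglex_irr.
- have := deglex_add2r t su; rewrite -uv e => /deglex_irr [].
- by rewrite tmin // mulr0.
Qed.

Lemma stratum_neq0 : (1 : L) <> 0.
Proof.
rewrite -(rmorph1 phi) => /to_stratum_eq0 /(_ 0 off0) /= /eqP.
by rewrite eqxx oner_eq0.
Qed.

Lemma stratum_domain : is_domain L.
Proof.
apply: (@localization_domain _ _ phi denominators).
- exact: denominators_unit.
- exact: denominators_normr.
- exact: denominators_frac.
- exact: to_stratum_domain.
- exact: stratum_neq0.
Qed.

Lemma phiX_cancel s z z' : off w s -> z * phi (X s) = z' * phi (X s) -> z = z'.
Proof.
by move=> /phiX_unit [y [xy _]] /(congr1 (fun z => z * y)); rewrite -!mulrA xy !mulr1.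
Qed.

(** * Commutation classes and components of ideals *)

Definition comm_class s : set expo :=
  [set t | forall u, off w u -> commutation u t = commutation u s].

Definition restrict (A : set expo) f : R :=
  QPS q (fun t => if `[< A t >] then qcoef f t else 0).

Definition supported (A : set expo) f := forall t, qcoef f t != 0 -> A t.

Lemma supported_restrict A f : supported A (restrict A f).
Proof. by move=> t /=; case: asboolP => //; rewrite eqxx. Qed.

Lemma restrict_supported A f : supported A f -> restrict A f = f.
Proof.
move=> h; apply: qpsP => t /=; case: asboolP => // nA.
by apply/esym/eqP/negPn/negP => /h.
Qed.

Lemma comm_classD s t u v : comm_class t v -> comm_class (s + t) (u + v) <-> comm_class s u.
Proof.
move=> tv; split=> h x xo; last by rewrite !commutationD h ?tv.
have := h x xo; rewrite !commutationD tv // => /mulIf; apply; exact: commutation_neq0.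
Qed.

(** The classes behave like a grading: by [comm_classD], a factor of class [t] carries the class of
    [s], and nothing else, to the class of [s + t]. *)
Lemma restrictM s t f g : supported (comm_class t) g ->
  restrict (comm_class (s + t)) (f * g) = restrict (comm_class s) f * g.
Proof.
move=> hg; apply: qpsP => v; rewrite [RHS]qcoefM big_seq.
have -> : qcoef (restrict (comm_class (s + t)) (f * g)) v =
  if `[< comm_class (s + t) v >] then qcoef (f * g) v else 0 by [].
rewrite qcoefM big_seq.
have e u : u \in below v -> qcoef g (expo_sub v u) != 0 ->
    `[< comm_class (s + t) v >] = `[< comm_class s u >].
  rewrite mem_below => uv /hg gv; rewrite -{1}(expo_subK uv).
  by apply/asboolP/asboolP => /(comm_classD _ _ gv).
transitivity (\sum_(u <- below v | u \in below v) if `[< comm_class (s + t) v >] then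
    qtwist q u (expo_sub v u) * qcoef f u * qcoef g (expo_sub v u) else 0).
  by case: ifP => // _; rewrite big1.
apply: eq_bigr => u uv /=; have [->|/(e u uv) ->] := eqVneq (qcoef g (expo_sub v u)) 0.
  by rewrite !mulr0; case: ifP.
by case: ifP; rewrite ?mulr0 ?mul0r.
Qed.

Lemma restrictZ A (c : k) f : restrict A (c *: f) = c *: restrict A f.
Proof. by apply: qpsP => t /=; case: ifP; rewrite ?mulr0. Qed.

Lemma restrictD A f g : restrict A (f + g) = restrict A f + restrict A g.
Proof. by apply: qpsP => t /=; case: ifP; rewrite ?addr0. Qed.

Lemma restrict_phi A f g : phi f = phi g -> phi (restrict A f) = phi (restrict A g).
Proof.
move=> e; have /to_stratum_eq0 h : phi (f - g) = 0 by rewrite rmorphB e subrr.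
apply: to_stratum_eq => s so /=; case: ifP => // _.
by apply/eqP; rewrite -subr_eq0; apply/eqP; apply: h.
Qed.

Lemma supportedX s : supported (comm_class s) (X s).
Proof. by move=> t; have [-> _ u //|/negPf ts] := eqVneq t s; rewrite /= ts eqxx. Qed.

Section IdealComponents.
Variable I : set L.
Hypothesis hI : is_ideal I.

Lemma ideal_hadamard u f : off w u -> I (phi f) -> I (phi (hadamard (commutation u) f)).
Proof.
have [_ _ IM IMr] := hI; move=> /phiX_unit [y [xy _]] If.
rewrite -[phi _]mulr1 -xy mulrA -rmorphM -X_hadamard rmorphM; apply: IMr; exact: IM.
Qed.

Lemma idealZ (c : k) f : I (phi f) -> I (phi (c *: f)).
Proof. by have [_ _ _ IMr] := hI; move=> If; rewrite -scaleM1 rmorphM; apply: IMr. Qed.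

(* Each conjugation by a monomial acts on x^t by a scalar; combining f with its
   conjugate kills one unwanted exponent at a time, and the infinitely many others
   are reached because right ideals are closed. *)
Lemma isolate_component s f (S : seq expo) : I (phi f) ->
  exists g, [/\ I (phi g), forall t, comm_class s t -> qcoef g t = qcoef f t &
    forall t, t \in S -> ~ comm_class s t -> qcoef g t = 0].
Proof.
move=> If; elim: S => [|t0 S [g [Ig gs gS]]]; first by exists f.
have [ct|nct] := pselect (comm_class s t0).
  by exists g; split=> // t; rewrite inE => /orP[/eqP -> //|]; apply: gS.
move/existsNP: nct => [u /not_implyP [uo /eqP nu]].
have nu0 : commutation u s - commutation u t0 != 0 by rewrite subr_eq0 eq_sym.
(* The coefficient at [t] is multiplied by the quotient of [commutation u t - commutation u t0] by
   [commutation u s - commutation u t0], which is 1 on the class of [s] and 0 at [t0]. *)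
exists ((commutation u s - commutation u t0)^-1 *:
  (hadamard (commutation u) g - commutation u t0 *: g)); split.
- apply: idealZ; rewrite rmorphB; apply: right_idealB (ideal_right hI) _ _.
    exact: ideal_hadamard.
  exact: idealZ.
- by move=> t ts /=; rewrite -mulrBl ts // mulrA mulVf ?mul1r ?gs.
move=> t; rewrite inE => /orP[/eqP -> _ /=|tS nts /=].
  by rewrite subrr mulr0.
by rewrite gS // !mulr0 subrr mulr0.
Qed.

Lemma ideal_restrict s f : I (phi f) -> I (phi (restrict (comm_class s) f)).
Proof.
move=> If; apply: (right_ideal_closed hq (I := phi @^-1` I)) => [|N].
  by apply: contraction_right_ideal; apply: ideal_right.
(* The box below the constant exponent [N] contains all exponents of degree at most [N]. *)
have [g [Ig gs gS]] := isolate_component s (below [ffun=> N]) If; exists g => // t tN.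
rewrite /=; case: asboolP => [/gs //|]; apply: gS; rewrite mem_below.
apply/expo_leP => i; rewrite ffunE; apply: leq_trans tN.
by rewrite /degree (bigD1 i) //= leq_addr.
Qed.

End IdealComponents.

(** * Central elements of [L_w] *)

Lemma supported_commute s f r : off w s -> supported (comm_class s) f ->
  phi (f * hadamard (fun t => (commutation s t)^-1) r) = phi (r * f).
Proof.
move=> so hf; apply: to_stratum_eq => v vo; rewrite !qcoefM [RHS]big_below_sub.
rewrite big_seq [RHS]big_seq; apply: eq_bigr => t; rewrite mem_below => tv /=.
rewrite expo_sub_sub //; have [->|/hf ft] := eqVneq (qcoef f t) 0.
  by rewrite !mulr0 mul0r.
have := ft _ (off_sub t vo); rewrite /commutation invf_div => <-.
have := qtwist_neq0 hq t (expo_sub v t); set d := expo_sub v t => td.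
by field.
Qed.

Lemma phiX_comm s f : phi f * phi (X s) =
  phi (X s) * phi (hadamard (fun t => (commutation s t)^-1) f).
Proof. by rewrite -!rmorphM hadamard_X. Qed.

(** By [supported_commute], [f] moves past elements of [R] exactly as [x^s] does, so [f x^-s]
    commutes with the image of [R], and then with all fractions. *)
Lemma supported_central s f z : off w s -> supported (comm_class s) f ->
  z * phi (X s) = phi f -> z \in @central L.
Proof.
move=> so hf e.
have zC r : z * phi r = phi r * z.
  apply: (phiX_cancel so); rewrite -!mulrA e phiX_comm mulrA e -!rmorphM.
  exact: supported_commute.
apply/asboolP => l; have [t [r [to er]]] := stratum_frac l.
by apply: (phiX_cancel to); rewrite -!mulrA er !zC mulrA er.
Qed.

Lemma central_supported z : z \in @central L ->
  exists s f, [/\ off w s, supported (comm_class s) f & z * phi (X s) = phi f].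
Proof.
move=> /asboolP zC; have [s [r [so e]]] := stratum_frac z.
exists s, (restrict (comm_class s) r); split=> //; first exact: supported_restrict.
rewrite e; apply: to_stratum_eq => t to /=; case: asboolP => // nt.
apply: contrapT => /eqP rt; apply: nt => u uo.
(* Centrality of [r x^-s] gives this relation; its coefficient at [u + t] forces
   [commutation u t = commutation u s] whenever [r] has a nonzero coefficient at [t]. *)
have : phi (X u * r) = phi (commutation u s *: (r * X u)).
  have -> : commutation u s *: (r * X u) = r * (commutation u s *: X u).
    by rewrite scalerAr.
  rewrite !rmorphM -e -!mulrA -!rmorphM -scalerAr.
  have -> : commutation u s *: (X s * X u) = X u * X s.
    by rewrite !XM scalerA divfK ?qtwist_neq0 // addrC.
  by rewrite rmorphM !mulrA zC.
move/eqP; rewrite -subr_eq0 -rmorphB => /eqP/to_stratum_eq0 /(_ (u + t)).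
rewrite offD uo to => /(_ isT); rewrite qcoefB qcoef_Xmul expo_le_addr expo_addK.
have -> : qcoef (commutation u s *: (r * X u)) (u + t) =
  commutation u s * qcoef (r * X u) (u + t) by [].
rewrite qcoef_mulX expo_le_addr expo_addK.
have -> : qtwist q u t = commutation u t * qtwist q t u by rewrite divfK ?qtwist_neq0.
rewrite -mulrA -mulrBl => /eqP; rewrite !mulf_eq0 (negPf rt) (negPf (qtwist_neq0 _ _ _)) //.
by rewrite !orbF subr_eq0 => /eqP.
Qed.

(** * Ideals of [L_w] versus ideals of its center *)

Local Notation Z := (center L).
Local Notation cval := (@center_val L).

(** It suffices to compare leading exponents of contractions to [R]. If [s] is off [w], the
    component of [f] in the class of [s] still leads at [s] and is a central element of [I] times
    [x^s]; otherwise [x^s] maps to 0. *)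
Lemma stratum_gen_central (I : set L) : is_ideal I -> I `<=` extend cval (cval @^-1` I).
Proof.
move=> hI; have hIr := ideal_right hI; set K := extend _ _.
have hK : is_right_ideal K by exact: extend_right_ideal.
have KI : K `<=` I by apply: extend_sub.
apply: (sub_of_contraction denominators_unit denominators_frac) => //.
apply: (right_ideal_sub hq); try exact: contraction_right_ideal.
  by move=> f; apply: KI.
move=> s [f If lf]; have [so|nso] := boolP (off w s); last first.
  exists (X s).
    change (K (phi (X s))); suff -> : phi (X s) = 0 by case: hK.
    by apply/to_stratum_eq0 => t to /=; case: eqP => // e; rewrite -e to in nso.
  split=> [|t ts] /=; first by rewrite eqxx oner_eq0.
  by case: eqP => // e; rewrite e in ts; case: (deglex_irr ts).
exists (restrict (comm_class s) f); last first.
  case: lf => fs fmin; split=> [|t /fmin ft] /=; last by case: ifP.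
  by case: asboolP => // -[].
have Ig := ideal_restrict hI s If; set g := restrict _ _ in Ig *.
have [y [xy yx]] := phiX_unit so; change (K (phi g)).
have cz : phi g * y \in @central L.
  apply: (supported_central so (supported_restrict (f := f))).
  by rewrite -mulrA yx mulr1.
have -> : phi g = cval (Center cz) * phi (X s) by rewrite /= -mulrA yx mulr1.
by apply: extendMl => /=; case: hI => _ _ _; apply.
Qed.

(* The graph of the projection of [L] onto its center that keeps the exponents of
   central monomials: for z = r x^-s these are the exponents of r in the
   commutation class of s. *)
Definition central_part z p := exists s r, [/\ off w s, z * phi (X s) = phi r &
  p * phi (X s) = phi (restrict (comm_class s) r)].

(** Multiplying numerators by [b], which has class [t], commutes with restriction by [restrictM];
    the scalar accounts for [x^s x^t] against [x^(s + t)]. With [a = 1] this enlarges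
    denominators. *)
Lemma central_partM s z p r a t b : off w s -> off w t -> a \in @central L ->
  a * phi (X t) = phi b -> supported (comm_class t) b -> z * phi (X s) = phi r ->
  p * phi (X s) = phi (restrict (comm_class s) r) ->
  exists r', a * z * phi (X (s + t)) = phi r' /\
    a * p * phi (X (s + t)) = phi (restrict (comm_class (s + t)) r').
Proof.
move=> so to /asboolP aC ea hb ez ep; exists ((qtwist q s t)^-1 *: (r * b)).
rewrite restrictZ restrictM //.
have main l g : l * phi (X s) = phi g ->
    a * l * phi (X (s + t)) = phi ((qtwist q s t)^-1 *: (g * b)).
  move=> el; rewrite XD -[_ *: (X s * X t)]scaleM1 -[_ *: (g * b)]scaleM1 !rmorphM !mulrA.
  congr (_ * _); by rewrite -(mulrA a) el aC -mulrA ea.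
by split; apply: main.
Qed.

Lemma central_part_shift s z p r t : off w s -> off w t -> z * phi (X s) = phi r ->
  p * phi (X s) = phi (restrict (comm_class s) r) ->
  exists r', z * phi (X (s + t)) = phi r' /\
    p * phi (X (s + t)) = phi (restrict (comm_class (s + t)) r').
Proof.
move=> so to ez ep.
have c1 : 1 \in @central L by apply/asboolP => l; rewrite mul1r mulr1.
have := central_partM so to c1 (mul1r _) (@supportedX t) ez ep; rewrite !mul1r; exact.
Qed.

Lemma central_part2 z p z' p' : central_part z p -> central_part z' p' ->
  exists s r r', [/\ off w s, z * phi (X s) = phi r,
    p * phi (X s) = phi (restrict (comm_class s) r),
    z' * phi (X s) = phi r' & p' * phi (X s) = phi (restrict (comm_class s) r')].
Proof.
move=> [s [r [so ez ep]]] [t [r' [to ez' ep']]].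
have [r1 [? ?]] := central_part_shift so to ez ep.
have [r2 [? ?]] := central_part_shift to so ez' ep'.
by exists (s + t), r1, r2; rewrite offD so to; split; rewrite // addrC.
Qed.

Lemma central_part_uniq z p p' : central_part z p -> central_part z p' -> p = p'.
Proof.
move=> h h'; have [s [r [r' [so ez ep ez' ep']]]] := central_part2 h h'.
by apply: (phiX_cancel so); rewrite ep ep'; apply: restrict_phi; rewrite -ez -ez'.
Qed.

Lemma central_partD z p z' p' : central_part z p -> central_part z' p' ->
  central_part (z + z') (p + p').
Proof.
move=> h h'; have [s [r [r' [so ez ep ez' ep']]]] := central_part2 h h'.
by exists s, (r + r'); rewrite restrictD !mulrDl !rmorphD ez ep ez' ep'.
Qed.

Lemma central_part_ex z : exists p : Z, central_part z (cval p).
Proof.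
have [s [r [so e]]] := stratum_frac z; have [y [xy yx]] := phiX_unit so.
have e' : phi (restrict (comm_class s) r) * y * phi (X s) =
  phi (restrict (comm_class s) r) by rewrite -mulrA yx mulr1.
exists (Center (supported_central so (@supported_restrict _ r) e')).
by exists s, r.
Qed.

Lemma central_part_center (a : Z) z p : central_part z p ->
  central_part (cval a * z) (cval a * p).
Proof.
move=> [s [r [so ez ep]]]; have [t [b [to hb ea]]] := central_supported (center_valP a).
have [r' [e1 e2]] := central_partM so to (center_valP a) ea hb ez ep.
by exists (s + t), r'; rewrite offD so to.
Qed.

Lemma central_part_id (a : Z) : central_part (cval a) (cval a).
Proof.
have [s [f [so hf e]]] := central_supported (center_valP a).
by exists s, f; rewrite restrict_supported.
Qed.

(** The projection is linear over the center and fixes it: applied to [c = \sum b_i l_i] it gives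
    [c = \sum b_i p_i] with central [p_i]. *)
Lemma stratum_ext_central (a : set Z) (c : Z) : is_ideal a ->
  extend cval a (cval c) -> a c.
Proof.
move=> [a0 aD aM aMr] [m [b [l [ab e]]]].
have /choice [p hp] := fun i => central_part_ex (l i).
have : central_part (cval c) (cval (\sum_(i < m) b i * p i)).
  have -> : cval (\sum_(i < m) b i * p i) = \sum_(i < m) cval (b i) * cval (p i).
    by apply: (big_ind2 (fun (x : Z) y => cval x = y)) => // x _ y _ <- <-.
  rewrite e; apply: (big_ind2 central_part) => [|? ? ? ?|i _].
  - exact: (central_part_id 0).
  - exact: central_partD.
  - by apply: central_part_center.
move=> /(central_part_uniq (central_part_id c)) /(@val_inj _ _ Z) ->.
by apply: (big_ind a) => // i _; apply: aMr.
Qed.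

(** An ascending chain in the center, extended to [L_w] and contracted to [R], becomes stationary
    there, and both operations are injective on the ideals concerned. *)
Lemma stratum_center_noetherian : noetherian (center L).
Proof.
move=> I hI Iinc.
have hE m : is_right_ideal (extend cval (I m)) by exact: extend_right_ideal.
have [||N hN] := right_noetherian_qps hq (I := fun m => phi @^-1` (extend cval (I m))).
- by move=> m; apply: contraction_right_ideal.
- by move=> m r; apply: extendS.
exists N => m /hN e; have ext_eq : extend cval (I m) = extend cval (I N).
  apply/seteqP; split; apply: (sub_of_contraction denominators_unit denominators_frac);
    by rewrite // e.
rewrite -(ext_center_val stratum_ext_central (hI m)) ext_eq.
exact (ext_center_val stratum_ext_central (hI N)).
Qed.

Lemma stratum_center_domain : is_domain (center L).
Proof.
have [L1 dom] := stratum_domain; split=> [e|x y e]; first exact: L1 (congr1 cval e).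
have [] : cval x = 0 \/ cval y = 0 by apply: dom; exact: (congr1 cval e).
  by left; apply: val_inj.
by right; apply: val_inj.
Qed.

(** * Strata as spectra of localizations *)

(** Puts the stratum in the form needed by [localization_homeomorphism]. A prime avoiding each [x_i]
    with [i] not in [w] avoids all monomials in them, since monomials off [w] are normal. *)
Lemma spec_wE (P : spec R) : spec_w q w P <->
  (forall r, phi r = 0 -> prime_of P r) /\ (forall x, denominators x -> ~ prime_of P x).
Proof.
have hP := prime_ofP P; have [[_ _ PM PMr] _ _] := hP; split=> [hw|[kP SP] i].
  split=> [r /to_stratum0|x [c [s [c0 so ->]]]].
    by move: r; apply: ideal_gen_sub => [|_ [i /= iw <-]]; [case: hP|apply/hw].
  move/(PMr (c^-1 *: 1)); rewrite scaleM1 scalerA mulVf // scale1r.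
  elim/expo_unit_ind: s so => [_|i s IH]; first exact: (prime_ideal_neq1 hP).
  rewrite offD off_unit => /andP[iw so].
  move/(PMr (qtwist q (unit_expo i) s *: 1)); rewrite scaleM1 -XM => h.
  have [r|/hw iw'|] := prime_ideal_elt (a := X (unit_expo i)) (b := X s) hP _.
  - rewrite -mulrA; have [r' ->] := denominators_normr r (denominatorsX so).
    by rewrite mulrA; apply: PMr.
  - by rewrite iw' in iw.
  - exact: IH.
split=> [Pi|iw]; last first.
  by apply: kP; apply/to_stratum0; apply: sub_ideal_gen; exists i.
apply: contraT => iw; case: (SP (qX q i) _ Pi).
by apply: denominatorsX; rewrite off_unit.
Qed.

(** [J_w] is the contraction of the zero ideal of the domain [L_w]. *)
Lemma Jw_prime : prime_ideal (tsideal_set (Jw q w)).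
Proof.
have -> : tsideal_set (Jw q w) = phi @^-1` [set 0].
  by apply/seteqP; split=> r /to_stratum0.
apply: (contraction_prime denominators_unit denominators_normr denominators_frac
  (right_noetherian_qps hq)).
have [L1 dom] := stratum_domain; split.
- by split=> [//|x y -> ->|a x ->|a x ->]; rewrite /= ?addr0 ?mulr0 ?mul0r.
- by move=> e; apply: L1; have : [set 0] (1 : L) by rewrite e.
move=> I J hI hJ IJ; have [I0|nI0] := pselect (I `<=` [set 0]); [by left|right=> b Jb].
move/existsNP: nI0 => [a /not_implyP [Ia a0]].
by have [/a0|//] := dom _ _ (IJ _ _ Ia Jb).
Qed.

Lemma spec_w_Jw : spec_w q w (Spec Jw_prime).
Proof.
apply/spec_wE; split=> [r /to_stratum0 //|x xS /to_stratum0 x0].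
have [y [xy _]] := denominators_unit xS.
by apply: stratum_neq0; rewrite -xy x0 mul0r.
Qed.

Lemma spec_w_sub (P : spec R) : spec_w q w P -> tsideal_set (Jw q w) `<=` prime_of P.
Proof. by move=> /spec_wE [kP _] r /to_stratum0 /kP. Qed.

Lemma spec_w_localization : exists Theta : set_type (spec_w q w) -> spec L,
  [/\ is_homeomorphism Theta,
      forall P, prime_of (Theta P) =
        extend (to_Lw w hq) (to_quot (Jw q w) @` prime_of (set_val P)) &
      exists P, prime_of (set_val P) = tsideal_set (Jw q w) /\
        prime_of (Theta P) = [set 0]].
Proof.
have [Theta [hT TE]] := localization_homeomorphism denominatorsM denominators_unit
  denominators_normr denominators_norml denominators_frac (right_noetherian_qps hq) spec_wE.
exists Theta; split=> // [P|]; first by rewrite extend_image TE.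
exists (SigSub (mem_set spec_w_Jw)); split=> //; rewrite TE.
apply/seteqP; split=> [|_ ->]; last by case: (extend_right_ideal phi (Jw q w)).
apply: extend_sub => [|a /to_stratum0 //].
by split=> [//|x y -> ->|x a ->]; rewrite /= ?addr0 ?mul0r.
Qed.

Lemma spec_w_center_homeomorphic : homeomorphic (set_type (spec_w q w)) (spec (center L)).
Proof.
have [Theta [hT _ _]] := spec_w_localization.
apply: (homeomorphic_trans hT).
exact: spec_center_homeomorphic stratum_gen_central stratum_ext_central.
Qed.

(** * Local closedness and closures of strata *)

Lemma locally_closed_spec_w : locally_closed (spec_w q w).
Proof.
pose V i := Vset (ideal_gen [set qX q i]).
have clV (I : set R) : is_ideal I -> closed (Vset I).
  by move=> hI; rewrite -[Vset _]setCK; apply/open_closedC/open_compl_Vset.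
exists (~` \bigcup_(i in [set` ~: w]) V i), (Vset (Jw q w)); split.
- apply: closed_openC; apply: closed_bigcup; first exact: finite_finset.
  by move=> i _; apply/clV/ideal_gen_ideal.
- exact/clV/tsidealP.
apply/seteqP; split=> P.
  move=> hP; split; last exact: spec_w_sub.
  move=> [i /= iw sub]; move: iw; rewrite inE => /negP; apply; apply/hP.
  by apply: sub; apply: sub_ideal_gen.
move=> [CP JP] i; split=> [Pi|iw]; last by apply: JP; apply: sub_ideal_gen; exists i.
apply: contraT => iw; have : [set` ~: w] i by rewrite /= inE.
move=> wi; case: CP; exists i => //; apply: ideal_gen_sub => [|_ -> //].
by case: (prime_ofP P).
Qed.

End Stratum.

Lemma spec_w_cover (k : fieldType) (n : nat) (q : 'M[k]_n) (P : spec (qps q)) :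
  spec_w q [set i | `[< prime_of P (qX q i) >]] P.
Proof. by move=> i; rewrite inE; split=> /asboolP. Qed.

(** [J_w] is a generic point of the stratum: it lies in every prime [P] of [Spec_w'] with [w]
    contained in [w'], so every neighbourhood of [P] contains it. *)
Lemma closure_spec_w (k : fieldType) (n : nat) (q : 'M[k]_n) (hq : mult_antisym q)
    (w : {set 'I_n}) :
  closure (spec_w q w) = \bigcup_(w' in [set w' : {set 'I_n} | w \subset w']) spec_w q w'.
Proof.
apply/seteqP; split=> [|P [w' /= ww' hP]].
  have cJ : closed (Vset (Jw q w)).
    by rewrite -[Vset _]setCK; apply/open_closedC/open_compl_Vset/tsidealP.
  move=> P /(closure_subset (spec_w_sub hq (w := w))) /cJ JP.
  exists [set i | `[< prime_of P (qX q i) >]]%SET; last exact: spec_w_cover.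
  apply/fintype.subsetP => i iw; rewrite inE; apply/asboolP; apply: JP.
  by apply: sub_ideal_gen; exists i.
move=> B; rewrite nbhsE => -[U [[I hI ->] nIP] UB].
exists (Spec (Jw_prime hq w)); split; first exact: spec_w_Jw.
apply: UB => /= IJ; apply: nIP => r /IJ /=; move: r; apply: ideal_gen_sub.
  by case: (prime_ofP P).
by move=> _ [i /= iw <-]; apply/hP; apply: (fintype.subsetP ww').
Qed.

Theorem mainTheorem8 (k : fieldType) (n : nat) (hn : (1 <= n)%N)
    (q : 'M[k]_n) (hq : mult_antisym q) :
  [/\ [/\ [set: spec (qps q)] = \bigcup_(w in [set: {set 'I_n}]) spec_w q w,
          trivIset [set: {set 'I_n}] (spec_w q),
          forall w : {set 'I_n}, locally_closed (spec_w q w) &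
          forall w : {set 'I_n}, exists D : set {set 'I_n},
            closure (spec_w q w) = \bigcup_(w' in D) spec_w q w'],
      forall w : {set 'I_n},
        exists Theta : set_type (spec_w q w) -> spec (Lw w hq),
          [/\ is_homeomorphism Theta,
              forall P, prime_of (Theta P) =
                extend (to_Lw w hq) (to_quot (Jw q w) @` prime_of (set_val P)) &
              exists P, prime_of (set_val P) = tsideal_set (Jw q w) /\
                prime_of (Theta P) = [set 0]] &
      forall w : {set 'I_n},
        [/\ is_domain (center (Lw w hq)), noetherian (center (Lw w hq)) &
            homeomorphic (set_type (spec_w q w)) (spec (center (Lw w hq)))]].
Proof.
split.
- split.
  + apply/seteqP; split=> // P _; exists [set i | `[< prime_of P (qX q i) >]]%SET => //.
    exact: spec_w_cover.
  + move=> w1 w2 _ _ [P [h1 h2]]; apply/setP => i.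
    by apply/idP/idP => [/h1/h2|/h2/h1].
  + by move=> w; apply: locally_closed_spec_w.
  + move=> w; exists [set w' : {set 'I_n} | w \subset w']; exact: closure_spec_w.
- by move=> w; apply: spec_w_localization.
- move=> w; split; [exact: stratum_center_domain|exact: stratum_center_noetherian|].
  exact: spec_w_center_homeomorphic.
Qed.
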